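(* Let $(M,F)$ be a rotational Randers surface of revolution with vertex $p$. For any point $q\neq p$, let $\gamma$ be a geodesic of $(M,F)$ from $q$ which is not tangent to the twisted meridian through $q$. Then $\gamma$ cannot be a (forward) ray; that is, the vertex $p$ is the unique pole of $(M,F)$.
   Context: A Riemannian surface of revolution $(M,h)$ with vertex $p$ is a complete Riemannian manifold homeomorphic to $\mathbb R^2$ whose metric, in $h$-geodesic polar coordinates $(r,\theta)\in[0,\infty)\times(0,2\pi]$ around $p$ ($\theta$ mod $2\pi$), is $h=dr^2+m^2(r)\,d\theta^2$, where $m:[0,\infty)\to[0,\infty)$ is a smooth odd function with $m(0)=0$, $m'(0)=1$ (and $m(r)>0$ for $r>0$). Let $\mu>0$ be a constant with $m(r)<\frac1\mu$ for all $r\ge0$, and let $W=\mu\frac{\partial}{\partial\theta}$. The rotational Randers metric with navigation data $(h,W)$ is $F(x,y)=\frac{\sqrt{\lambda\,h(y,y)+h(W,y)^2}}{\lambda}-\frac{h(W,y)}{\lambda}$, $\lambda=1-\mu^2m^2(r)$. Let $d_F$ be the induced (in general non-symmetric) distance. A meridian is an $h$-unit speed geodesic $s\mapsto(r(s),\theta_0)=(s,\theta_0)$, $s\ge0$, from $p$; the corresponding twisted meridian is $\mathcal P(s)=(s,\theta_0+\mu s)$, $s\ge 0$, which is an $F$-unit speed geodesic from $p$. Through each $q\ne p$ there passes exactly one twisted meridian. A unit speed geodesic $\gamma:[0,\infty)\to M$ of $(M,F)$ is a (forward) ray if $d_F(\gamma(0),\gamma(s))=s$ for all $s\ge0$. A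 point of $(M,F)$ is a pole if any two geodesics from it do not meet again, i.e. its cut locus is empty. *)

(* Defs.v *)
From Stdlib Require Import Reals Lra.
From Coquelicot Require Import Coquelicot.
Open Scope R_scope.

(* The surface is modelled on the plane R * R by the global chart
   (r, theta) |-> (r cos theta, r sin theta) built from h-geodesic polar
   coordinates (normal coordinates at the vertex); tangent vectors are
   given by their components in this chart.  Since [m] is odd and smooth with
   [m' 0 = 1], h extends smoothly across the origin, where it is the Euclidean
   inner product; h is complete because [r] runs over all of [0, +oo). *)
Definition vertex : R * R := (0, 0).

Definition radius (x : R * R) : R := sqrt (fst x ^ 2 + snd x ^ 2).

(* A smooth odd function on [0, +oo) is one whose odd extension to R is smooth;
   [m] stands for that extension. *)
Record warping_function (m : R -> R) : Prop := {
  warping_smooth : forall (n : nat) (r : R), ex_derive_n m n r;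
  warping_odd : forall r : R, m (- r) = - m r;
  warping_0 : m 0 = 0;
  warping_derive_0 : is_derive m 0 1;
  warping_pos : forall r : R, 0 < r -> 0 < m r }.

(* The 1-forms dr and d(theta), meaningful away from the vertex. *)
Definition dr (x v : R * R) : R :=
  (fst x * fst v + snd x * snd v) / radius x.
Definition dtheta (x v : R * R) : R :=
  (fst x * snd v - snd x * fst v) / radius x ^ 2.

Definition h (m : R -> R) (x v w : R * R) : R :=
  if Req_EM_T (radius x) 0 then fst v * fst w + snd v * snd w
  else dr x v * dr x w + m (radius x) ^ 2 * (dtheta x v * dtheta x w).

(* mu * d/d(theta) *)
Definition wind (mu : R) (x : R * R) : R * R := (- (mu * snd x), mu * fst x).

Definition lambda (m : R -> R) (mu : R) (x : R * R) : R :=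
  1 - mu ^ 2 * m (radius x) ^ 2.

Definition randers (m : R -> R) (mu : R) (x y : R * R) : R :=
  sqrt (lambda m mu x * h m x y y + h m x (wind mu x) y ^ 2) / lambda m mu x
  - h m x (wind mu x) y / lambda m mu x.

(* Derivative of a plane curve at [t] relative to the domain [D]
   (one-sided at an end point of an interval [D]). *)
Definition is_velocity (D : R -> Prop) (c : R -> R * R) (t : R) (v : R * R) : Prop :=
  filterdiff c (within D (locally t)) (fun s => scal s v).

Definition C1_curve (D : R -> Prop) (c v : R -> R * R) : Prop :=
  (forall t, D t -> is_velocity D c t (v t)) /\ continuous_on D v.

(* [path_length m mu x y l]: some piecewise C^1 curve from [x] to [y] has
   F-length [l]. *)
Inductive path_length (m : R -> R) (mu : R) : R * R -> R * R -> R -> Prop :=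
| path_length_C1 (a b : R) (c v : R -> R * R) :
    a < b -> C1_curve (fun t => a <= t <= b) c v ->
    path_length m mu (c a) (c b) (RInt (fun t => randers m mu (c t) (v t)) a b)
| path_length_concat (x y z : R * R) (l1 l2 : R) :
    path_length m mu x y l1 -> path_length m mu y z l2 ->
    path_length m mu x z (l1 + l2).

Definition dist_F (m : R -> R) (mu : R) (x y : R * R) : Rbar :=
  Glb_Rbar (path_length m mu x y).

(* The Lagrangian F^2 / 2 and its partial derivatives with respect to position
   and velocity; it is smooth wherever [y] is nonzero, also over the vertex. *)
Definition energy (m : R -> R) (mu : R) (x y : R * R) : R :=
  randers m mu x y ^ 2 / 2.

Definition energy_x1 (m : R -> R) (mu : R) (x y : R * R) : R :=
  Derive (fun u => energy m mu (u, snd x) y) (fst x).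
Definition energy_x2 (m : R -> R) (mu : R) (x y : R * R) : R :=
  Derive (fun u => energy m mu (fst x, u) y) (snd x).
Definition energy_y1 (m : R -> R) (mu : R) (x y : R * R) : R :=
  Derive (fun u => energy m mu x (u, snd y)) (fst y).
Definition energy_y2 (m : R -> R) (mu : R) (x y : R * R) : R :=
  Derive (fun u => energy m mu x (fst y, u)) (snd y).

Definition half_line (t : R) : Prop := 0 <= t.

(* F-unit speed solutions on [0, +oo) of the Euler-Lagrange equations of
   [energy].  Values of a curve at negative parameters are irrelevant.  A C^1
   solution is automatically smooth, the Lagrangian being regular. *)
Definition unit_speed_geodesic (m : R -> R) (mu : R) (gamma : R -> R * R) : Prop :=
  exists v : R -> R * R,
    C1_curve half_line gamma v /\
    (forall t, 0 <= t -> randers m mu (gamma t) (v t) = 1) /\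
    (forall t, 0 <= t ->
       filterdiff (fun s => energy_y1 m mu (gamma s) (v s))
         (within half_line (locally t))
         (fun s => scal s (energy_x1 m mu (gamma t) (v t)))) /\
    (forall t, 0 <= t ->
       filterdiff (fun s => energy_y2 m mu (gamma s) (v s))
         (within half_line (locally t))
         (fun s => scal s (energy_x2 m mu (gamma t) (v t)))).

Definition forward_ray (m : R -> R) (mu : R) (gamma : R -> R * R) : Prop :=
  unit_speed_geodesic m mu gamma /\
  forall s, 0 <= s -> dist_F m mu (gamma 0) (gamma s) = Finite s.

Definition twisted_meridian (mu theta0 s : R) : R * R :=
  (s * cos (theta0 + mu * s), s * sin (theta0 + mu * s)).

(* [gamma] is tangent at its initial point to a twisted meridian through that
   point: the two velocities span the same line. *)
Definition tangent_to_twisted_meridian (mu : R) (gamma : R -> R * R) : Prop :=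
  exists (theta0 s k : R) (v w : R * R),
    0 <= s /\ twisted_meridian mu theta0 s = gamma 0 /\
    is_velocity half_line gamma 0 v /\
    is_derive (twisted_meridian mu theta0) s w /\
    v = scal k w.

(* Distinct geodesics issuing from [x] have no common point after their start. *)
Definition pole (m : R -> R) (mu : R) (x : R * R) : Prop :=
  forall gamma1 gamma2 : R -> R * R,
    unit_speed_geodesic m mu gamma1 -> unit_speed_geodesic m mu gamma2 ->
    gamma1 0 = x -> gamma2 0 = x ->
    (exists t, 0 <= t /\ gamma1 t <> gamma2 t) ->
    forall s t, 0 < s -> 0 <= t -> gamma1 s <> gamma2 t.

(* Main.v *)
Require Import Defs.
From Stdlib Require Import Reals Lra Lia.
From Coquelicot Require Import Coquelicot.
Open Scope R_scope.

(** Write [M = m(r)^2], [a = dr(y)], [b = dtheta(y)].  A vector [y] is an F-unit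
    vector exactly when [a^2 + M (b - mu)^2 = 1]: F-unit vectors are h-unit vectors
    translated by the wind, and F-geodesics are h-geodesics carried along by the
    rotation of angular velocity [mu].  The quantity [nu = M (b - mu)] is the
    Clairaut constant of the underlying h-geodesic.

    Rays.  Since [M < 1 / mu^2], changing the angle is cheap at large distances:
    from [x] off the vertex one reaches any [z], whatever its angle, by a spiral of
    F-length at most sqrt((r(z) - r(x))^2 + (PI / mu)^2) ([dist_F_le_spiral]).  Along a ray from
    [q] this bounds the time [s] by sqrt((r(s) - r(0))^2 + (PI / mu)^2).  On the other hand
    [r(s) - s] never increases along a unit speed curve
    ([unit_speed_radius_increment]), so a strict loss at any time would persist and
    contradict that bound for large [s].  Hence [r(s) = r(0) + s] ([ray_radius]), which
    forces [a = 1] and [b = mu]: a ray leaves [q] along the twisted meridian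
    ([ray_initially_tangent]).

    The vertex is a pole.  Rotations preserve F, so the moment of the momentum,
    [x1 E_y2 - x2 E_y1], is constant along a geodesic ([energy_rotation_invariance]).
    It vanishes at the vertex, and elsewhere it equals [nu / (1 + mu nu)]; hence
    [nu = 0] all along a geodesic from the vertex, which must therefore be a twisted
    meridian ([vertex_geodesic_twisted_meridian]).  Distinct twisted meridians meet
    only at the vertex.

    Other points are not poles.  From a point at distance [r0 > 0], take the
    h-geodesic that starts along the parallel; its Clairaut constant is
    [nu = m(r0) > 0].  It exists for all time ([radial_profile]) and its angle grows at
    the rate [nu / m(r)^2 >= nu mu^2], so it turns by [PI] in finite time.
    At that time it meets its mirror image in the meridian of the point.  Carried
    along by the rotation, the two curves become F-geodesics ([polar_geodesic]), and
    since they meet at equal times they still meet ([pole_is_vertex]). *)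

(** * Polar coordinates in the plane *)

Lemma radius_nonneg (x : R * R) : 0 <= radius x.
Proof. apply sqrt_pos. Qed.

Lemma radius_sqr (x : R * R) : radius x ^ 2 = fst x ^ 2 + snd x ^ 2.
Proof. unfold radius; rewrite pow2_sqrt; nra. Qed.

Lemma radius_eq0 (x : R * R) : radius x = 0 -> x = vertex.
Proof.
  intros Hx; pose proof (radius_sqr x) as Hs; rewrite Hx in Hs.
  destruct x as [x1 x2]; simpl in Hs; unfold vertex; f_equal; nra.
Qed.

Lemma radius_pos (x : R * R) : x <> vertex -> 0 < radius x.
Proof.
  intros Hx; destruct (radius_nonneg x) as [H | H]; [exact H |].
  exfalso; apply Hx, radius_eq0; symmetry; exact H.
Qed.

Lemma radius_vertex : radius vertex = 0.
Proof.
  unfold radius, vertex; simpl.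
  replace (0 * (0 * 1) + 0 * (0 * 1)) with 0 by ring; apply sqrt_0.
Qed.

Lemma radius_scaled_circle (r c s : R) :
  0 <= r -> c ^ 2 + s ^ 2 = 1 -> radius (r * c, r * s) = r.
Proof.
  intros Hr H; unfold radius; simpl fst; simpl snd.
  replace (_ + _) with (r ^ 2 * (c ^ 2 + s ^ 2)) by ring.
  rewrite H, Rmult_1_r; apply sqrt_pow2, Hr.
Qed.

Lemma cos_sin_sqr (t : R) : cos t ^ 2 + sin t ^ 2 = 1.
Proof. pose proof (sin2_cos2 t) as H; unfold Rsqr in H; lra. Qed.

Lemma unit_vector_angle (c s : R) :
  c ^ 2 + s ^ 2 = 1 -> exists d : R, - PI <= d <= PI /\ cos d = c /\ sin d = s.
Proof.
  intros H; assert (Hc : -1 <= c <= 1) by nra.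
  pose proof (acos_bound c) as [H0 HPI].
  assert (Hsin : sin (acos c) = Rabs s).
  { rewrite sin_acos by exact Hc.
    replace (1 - Rsqr c) with (Rsqr s) by (unfold Rsqr; nra). apply sqrt_Rsqr_abs. }
  destruct (Rle_lt_dec 0 s) as [Hs | Hs].
  - exists (acos c); rewrite Hsin, Rabs_pos_eq, cos_acos by assumption.
    repeat split; lra.
  - exists (- acos c); rewrite cos_neg, sin_neg, Hsin, Rabs_left, cos_acos by assumption.
    repeat split; lra.
Qed.

Lemma polar_angle (x : R * R) :
  exists th : R, x = (radius x * cos th, radius x * sin th).
Proof.
  destruct (Req_dec (radius x) 0) as [H0 | H0].
  - exists 0; rewrite H0, !Rmult_0_l; apply radius_eq0, H0.
  - pose proof (radius_sqr x) as Hs.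
    destruct (unit_vector_angle (fst x / radius x) (snd x / radius x)) as [d [_ [Hc Hsn]]].
    { replace (_ + _) with ((fst x ^ 2 + snd x ^ 2) / radius x ^ 2) by (field; exact H0).
      rewrite <- Hs; field; exact H0. }
    exists d; rewrite Hc, Hsn; destruct x as [x1 x2]; simpl; f_equal; field; exact H0.
Qed.

Lemma dr_polar (r c s a b : R) :
  0 < r -> c ^ 2 + s ^ 2 = 1 ->
  dr (r * c, r * s) (a * c - r * b * s, a * s + r * b * c) = a.
Proof.
  intros Hr H; unfold dr; rewrite radius_scaled_circle by lra; simpl fst; simpl snd.
  replace (_ + _) with (r * (a * (c ^ 2 + s ^ 2))) by ring.
  rewrite H; field; lra.
Qed.

Lemma dtheta_polar (r c s a b : R) :
  0 < r -> c ^ 2 + s ^ 2 = 1 ->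
  dtheta (r * c, r * s) (a * c - r * b * s, a * s + r * b * c) = b.
Proof.
  intros Hr H; unfold dtheta; rewrite radius_scaled_circle by lra; simpl fst; simpl snd.
  replace (_ - _) with (r ^ 2 * (b * (c ^ 2 + s ^ 2))) by ring.
  rewrite H; field; lra.
Qed.

(** [x] and its rotation by a right angle are an orthogonal basis, so the two products
    determine [v]: it is the vector [d/dr + k d/dtheta]. *)
Lemma velocity_from_dot_cross (x1 x2 v1 v2 r k : R) :
  r <> 0 -> x1 ^ 2 + x2 ^ 2 = r ^ 2 ->
  x1 * v1 + x2 * v2 = r -> x1 * v2 - x2 * v1 = k * r ^ 2 ->
  v1 = x1 / r - k * x2 /\ v2 = x2 / r + k * x1.
Proof.
  intros Hr Hs Hdot Hcross.
  split; apply (Rmult_eq_reg_l (r ^ 2)); try (apply pow_nonzero; exact Hr).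
  - transitivity (x1 * r - x2 * (k * r ^ 2)).
    + rewrite <- Hcross, <- Hs, <- Hdot; ring.
    + field; exact Hr.
  - transitivity (x2 * r + x1 * (k * r ^ 2)).
    + rewrite <- Hcross, <- Hs, <- Hdot; ring.
    + field; exact Hr.
Qed.

Lemma is_derive_radius_1 (x1 x2 : R) :
  radius (x1, x2) <> 0 ->
  is_derive (fun u => radius (u, x2)) x1 (x1 / radius (x1, x2)).
Proof.
  intros Hx; pose proof (radius_nonneg (x1, x2)) as H0.
  pose proof (radius_sqr (x1, x2)) as Hs.
  unfold radius in *; simpl fst in *; simpl snd in *; auto_derive.
  - simpl in *; nra.
  - simpl in *; field; exact Hx.
Qed.

Lemma is_derive_radius_2 (x1 x2 : R) :
  radius (x1, x2) <> 0 ->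
  is_derive (fun u => radius (x1, u)) x2 (x2 / radius (x1, x2)).
Proof.
  intros Hx.
  assert (E : forall u v : R, radius (u, v) = radius (v, u)).
  { intros u v; unfold radius; simpl fst; simpl snd; f_equal; ring. }
  rewrite E in *; apply (is_derive_ext (fun u => radius (u, x1)));
    [intros; apply E | apply is_derive_radius_1; exact Hx].
Qed.

(** * The Randers norm in polar coordinates *)

(** The Randers norm of a vector with [dr = a] and [dtheta = b], with [M] standing for
    [m(r)^2].  In the radicand of the defining formula, [h(W, y)^2 = (M mu b)^2] cancels
    against the part [- mu^2 M^2 b^2] of [lambda h(y, y)]. *)
Definition polar_speed (mu M a b : R) : R :=
  (sqrt ((1 - mu ^ 2 * M) * a ^ 2 + M * b ^ 2) - mu * M * b) / (1 - mu ^ 2 * M).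

Lemma randers_polar (m : R -> R) (mu : R) (x y : R * R) :
  radius x <> 0 ->
  randers m mu x y = polar_speed mu (m (radius x) ^ 2) (dr x y) (dtheta x y).
Proof.
  intros Hx; pose proof (radius_sqr x) as Hs.
  assert (Hr : dr x (wind mu x) = 0) by (unfold dr, wind; simpl; field; exact Hx).
  assert (Ht : dtheta x (wind mu x) = mu).
  { unfold dtheta, wind; simpl fst; simpl snd.
    replace (fst x * (mu * fst x) - snd x * - (mu * snd x))
      with (mu * (fst x ^ 2 + snd x ^ 2)) by ring.
    rewrite <- Hs; field; exact Hx. }
  unfold randers, polar_speed, lambda, h.
  destruct (Req_EM_T (radius x) 0) as [H0 | _]; [contradiction |].
  rewrite Hr, Ht.
  set (M := m (radius x) ^ 2); set (a := dr x y); set (b := dtheta x y).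
  replace ((1 - mu ^ 2 * M) * (a * a + M * (b * b)) + (0 * a + M * (mu * b)) ^ 2)
    with ((1 - mu ^ 2 * M) * a ^ 2 + M * b ^ 2) by ring.
  unfold Rdiv; ring.
Qed.

Lemma randers_vertex (m : R -> R) (mu : R) (y : R * R) :
  m 0 = 0 -> randers m mu vertex y = sqrt (fst y ^ 2 + snd y ^ 2).
Proof.
  intros H0; unfold randers, lambda, h; rewrite radius_vertex, H0.
  destruct (Req_EM_T 0 0) as [_ | H]; [| lra].
  unfold wind, vertex; simpl fst; simpl snd.
  match goal with |- context [sqrt ?e] =>
    replace e with (fst y ^ 2 + snd y ^ 2) by ring end.
  field.
Qed.

Section Speed.
Variables mu M : R.
Hypothesis HM : 0 <= M.
Hypothesis HmuM : mu ^ 2 * M < 1.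

(** By Cauchy-Schwarz, the h-product of the wind and of a vector of h-length at most 1
    exceeds [-1], the wind being shorter than 1. *)
Lemma momentum_factor_pos (a b : R) :
  a ^ 2 + M * (b - mu) ^ 2 <= 1 -> 0 < 1 + mu * (M * (b - mu)).
Proof.
  intros H.
  assert (Hk : (mu * (M * (b - mu))) ^ 2 < 1).
  { replace ((mu * (M * (b - mu))) ^ 2)
      with ((mu ^ 2 * M) * (M * (b - mu) ^ 2)) by ring.
    assert (0 <= M * (b - mu) ^ 2 <= 1)
      by (split; [apply Rmult_le_pos; [exact HM | apply pow2_ge_0] |
          pose proof (pow2_ge_0 a); lra]).
    assert (0 <= mu ^ 2 * M) by (apply Rmult_le_pos; [apply pow2_ge_0 | exact HM]).
    nra. }
  nra.
Qed.

(** F-unit balls are h-unit balls translated by the wind; here [(a, b - mu)] is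
    the vector before the translation. *)
Lemma polar_speed_le1 (a b : R) :
  a ^ 2 + M * (b - mu) ^ 2 <= 1 -> polar_speed mu M a b <= 1.
Proof.
  intros H; pose proof (momentum_factor_pos a b H) as HS.
  unfold polar_speed; apply Rle_div_l; [lra |].
  enough (sqrt ((1 - mu ^ 2 * M) * a ^ 2 + M * b ^ 2)
          <= 1 + mu * (M * (b - mu))) by lra.
  rewrite <- (sqrt_pow2 (1 + mu * (M * (b - mu)))) by lra.
  apply sqrt_le_1_alt.
  enough (0 <= (1 - mu ^ 2 * M) * (1 - a ^ 2 - M * (b - mu) ^ 2)) by nra.
  apply Rmult_le_pos; lra.
Qed.

(** On unit vectors the radicand of the norm is a perfect square, which is why the
    derivatives of the norm there contain no root. *)
Lemma radicand_unit (a b : R) :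
  a ^ 2 + M * (b - mu) ^ 2 = 1 ->
  (1 - mu ^ 2 * M) * a ^ 2 + M * b ^ 2 = (1 + mu * (M * (b - mu))) ^ 2.
Proof. intros H; replace (a ^ 2) with (1 - M * (b - mu) ^ 2) by lra; ring. Qed.

Lemma polar_speed_eq1 (a b : R) :
  polar_speed mu M a b = 1 <-> a ^ 2 + M * (b - mu) ^ 2 = 1.
Proof.
  split; intros H.
  - unfold polar_speed in H.
    assert (Hs : sqrt ((1 - mu ^ 2 * M) * a ^ 2 + M * b ^ 2)
                 = 1 - mu ^ 2 * M + mu * M * b).
    { apply (f_equal (Rmult (1 - mu ^ 2 * M))) in H.
      field_simplify in H; lra. }
    assert (Hp : 0 <= (1 - mu ^ 2 * M) * a ^ 2 + M * b ^ 2) by nra.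
    apply (f_equal (fun z => z ^ 2)) in Hs; rewrite pow2_sqrt in Hs by exact Hp.
    apply (Rmult_eq_reg_l (1 - mu ^ 2 * M)); [| lra]. nra.
  - pose proof (momentum_factor_pos a b (Req_le _ _ H)).
    unfold polar_speed; rewrite (radicand_unit a b H), sqrt_pow2 by lra.
    field; lra.
Qed.

End Speed.

(** At a unit vector the derivatives of F follow from the implicit equation
    [(a/F)^2 + M (b/F - mu)^2 = 1]; the common denominator is the h-product of
    [(a, b - mu)] and [(a, b)]. *)
Lemma is_derive_polar_speed (mu : R) (M a b : R -> R) (u dM da db : R) :
  0 <= M u -> mu ^ 2 * M u < 1 -> a u ^ 2 + M u * (b u - mu) ^ 2 = 1 ->
  is_derive M u dM -> is_derive a u da -> is_derive b u db ->
  is_derive (fun z => polar_speed mu (M z) (a z) (b z) ^ 2 / 2) u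
    ((a u * da + M u * (b u - mu) * db + (b u - mu) ^ 2 * dM / 2)
     / (1 + mu * (M u * (b u - mu)))).
Proof.
  intros HM HmuM H1 DM Da Db.
  pose proof (radicand_unit mu (M u) _ _ H1) as HR.
  pose proof (momentum_factor_pos mu (M u) HM HmuM _ _ (Req_le _ _ H1)) as HS.
  pose proof (proj2 (polar_speed_eq1 mu (M u) HM HmuM _ _) H1) as HF.
  set (S := 1 + mu * (M u * (b u - mu))) in *.
  assert (Hsq : sqrt ((1 - mu ^ 2 * M u) * a u ^ 2 + M u * b u ^ 2) = S)
    by (rewrite HR; apply sqrt_pow2; lra).
  assert (DF : is_derive (fun z => polar_speed mu (M z) (a z) (b z)) u
    ((a u * da + M u * (b u - mu) * db + (b u - mu) ^ 2 * dM / 2) / S)).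
  { assert (EM := is_derive_unique _ _ _ DM).
    assert (Ea := is_derive_unique _ _ _ Da).
    assert (Eb := is_derive_unique _ _ _ Db).
    unfold polar_speed; auto_derive.
    - simpl; simpl in HR; repeat split; try (eexists; eassumption).
      + replace (_ + _) with (S * (S * 1)) by (rewrite <- HR; ring).
        apply Rmult_lt_0_compat; lra.
      + lra.
    - change (fun x => M x) with M; change (fun x => a x) with a;
      change (fun x => b x) with b.
      rewrite ?EM, ?Ea, ?Eb.
      match goal with |- context [sqrt ?e] =>
        replace e with ((1 - mu ^ 2 * M u) * a u ^ 2 + M u * b u ^ 2) by ring end.
      rewrite Hsq.
      assert (HL : 1 - mu ^ 2 * M u <> 0) by lra.
      assert (HS' : S <> 0) by lra.
      (* The difference of the two sides is a multiple of the defect in [H1]. *)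
      apply Rminus_diag_uniq.
      match goal with |- ?e = _ => assert (E : e =
        - mu ^ 2 * dM / (2 * S * (1 - mu ^ 2 * M u))
        * (a u ^ 2 + M u * (b u - mu) ^ 2 - 1)) end.
      { unfold S in *; field; lra. }
      rewrite E, H1; ring. }
  set (l := (a u * da + M u * (b u - mu) * db + (b u - mu) ^ 2 * dM / 2) / S) in *.
  assert (El : l = / 2 * (INR 2 * l * polar_speed mu (M u) (a u) (b u) ^ pred 2))
    by (rewrite HF; simpl; field).
  rewrite El.
  apply (is_derive_ext (fun z => / 2 * polar_speed mu (M z) (a z) (b z) ^ 2)).
  { intros t; apply (Rmult_comm (/ 2)). }
  apply (is_derive_scal (fun z => polar_speed mu (M z) (a z) (b z) ^ 2)).
  apply (is_derive_pow (fun z => polar_speed mu (M z) (a z) (b z)) 2 u l DF).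
Qed.

Lemma continuous_polar_speed (mu : R) (M b : R -> R) (a t : R) :
  continuous M t -> continuous b t -> mu ^ 2 * M t < 1 ->
  continuous (fun s => polar_speed mu (M s) a (b s)) t.
Proof.
  intros CM Cb HM; unfold polar_speed, Rdiv.
  assert (CL : continuous (fun s => 1 - mu ^ 2 * M s) t).
  { apply (continuous_minus (fun _ => 1) (fun s => mu ^ 2 * M s)); [apply continuous_const |].
    apply (continuous_scal_r (mu ^ 2) M), CM. }
  apply (continuous_mult
    (fun s => sqrt ((1 - mu ^ 2 * M s) * a ^ 2 + M s * b s ^ 2) - mu * M s * b s)
    (fun s => / (1 - mu ^ 2 * M s))).
  - apply (continuous_minus (fun s => sqrt ((1 - mu ^ 2 * M s) * a ^ 2 + M s * b s ^ 2))
      (fun s => mu * M s * b s)).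
    + apply continuous_sqrt_comp.
      apply (continuous_plus (fun s => (1 - mu ^ 2 * M s) * a ^ 2) (fun s => M s * b s ^ 2)).
      * apply (continuous_mult (fun s => 1 - mu ^ 2 * M s) (fun _ => a ^ 2));
          [exact CL | apply continuous_const].
      * apply (continuous_mult M (fun s => b s ^ 2)); [exact CM |].
        apply (continuous_mult b (fun s => b s * 1)); [exact Cb |].
        apply (continuous_mult b (fun _ => 1)); [exact Cb | apply continuous_const].
    + apply (continuous_mult (fun s => mu * M s) b); [| exact Cb].
      apply (continuous_scal_r mu M), CM.
  - apply continuous_Rinv_comp; [exact CL | lra].
Qed.

(** * Calculus on the half-line *)

(** Away from the end point 0 a derivative relative to the half-line is an ordinary
    one, so that the usual rules of calculus apply there. *)
Lemma filterdiff_half_line_interior {V : NormedModule R_AbsRing}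
    (f : R -> V) (l : R -> V) (t : R) :
  0 < t -> filterdiff f (within half_line (locally t)) l -> filterdiff f (locally t) l.
Proof.
  intros Ht [Hl Hd]; split; [exact Hl |].
  intros x Hx eps.
  assert (Hi : locally t half_line).
  { generalize (open_gt 0 t Ht); apply filter_imp; intros y Hy; left; exact Hy. }
  assert (Hx' : is_filter_lim (within half_line (locally t)) x).
  { intros P HP; apply filter_le_within, Hx, HP. }
  generalize (filter_and _ _ Hi (Hd x Hx' eps)); apply filter_imp.
  intros y [H1 H2]; exact (H2 H1).
Qed.

Lemma filterdiff_within {V : NormedModule R_AbsRing} (D : R -> Prop)
    (f : R -> V) (l : R -> V) (t : R) :
  D t -> filterdiff f (locally t) l -> filterdiff f (within D (locally t)) l.
Proof.
  intros Ht H.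
  assert (HF : ProperFilter (within D (locally t))).
  { split; [| apply within_filter, locally_filter].
    intros P HP; exists t; exact (locally_singleton _ _ HP Ht). }
  apply (filterdiff_locally f t); [| exact H].
  intros P HP; apply filter_le_within, HP.
Qed.

(** Extending by the value at 0 turns continuity relative to the half-line into
    continuity on the whole line, for which the algebraic rules are available. *)
Lemma continuous_on_half_line_extend {V : UniformSpace} (f : R -> V) :
  continuous_on half_line f -> forall t, continuous (fun s => f (Rmax 0 s)) t.
Proof.
  intros Hf t; unfold continuous.
  apply (filterlim_comp _ _ _ (fun s => Rmax 0 s) f _
           (within half_line (locally (Rmax 0 t)))).
  - intros P [d Hd]; exists d; intros s Hs; apply Hd; [| apply Rmax_l].
    unfold ball in *; simpl in *; unfold AbsRing_ball, abs, minus, plus, opp in *;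
      simpl in *.
    apply Rle_lt_trans with (2 := Hs).
    unfold Rmax, Rabs; repeat destruct Rle_dec; repeat destruct Rcase_abs; lra.
  - apply Hf, Rmax_l.
Qed.

(** The mean value inequality; at the end point, where a curve on the half-line has only
    a one-sided derivative, continuity takes its place. *)
Lemma half_line_increment (f l : R -> R) (c s t : R) :
  (forall u, continuous (fun z => f (Rmax 0 z)) u) ->
  (forall u, 0 < u -> is_derive f u (l u)) ->
  (forall u, 0 <= u -> l u <= c) ->
  0 <= s <= t -> f t - f s <= c * (t - s).
Proof.
  intros Hc Hd Hl [Hs Hst].
  destruct (Req_dec s t) as [<- | Hne]; [lra |].
  destruct (MVT_gen (fun z => f (Rmax 0 z)) s t l) as [u [Hu E]].
  - intros u Hu; rewrite Rmin_left, Rmax_right in Hu by lra.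
    apply (is_derive_ext_loc f).
    + assert (Hp : 0 < u) by lra.
      generalize (open_gt 0 u Hp); apply filter_imp; intros y Hy.
      rewrite Rmax_right; [reflexivity | lra].
    + apply Hd; lra.
  - intros u _; apply continuity_pt_filterlim, Hc.
  - rewrite Rmin_left, Rmax_right in Hu by lra.
    rewrite (Rmax_right 0 s), (Rmax_right 0 t) in E by lra.
    rewrite E; apply Rmult_le_compat_r; [lra | apply Hl; lra].
Qed.

Lemma half_line_affine (f : R -> R) (c : R) :
  (forall u, continuous (fun z => f (Rmax 0 z)) u) ->
  (forall u, 0 < u -> is_derive f u c) ->
  forall t, 0 <= t -> f t = f 0 + c * t.
Proof.
  intros Hc Hd t Ht.
  pose proof (half_line_increment f (fun _ => c) c 0 t Hc Hd
                (fun _ _ => Rle_refl c)) as Hup.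
  pose proof (half_line_increment (fun z => - f z) (fun _ => - c) (- c) 0 t
    (fun u => continuous_opp _ u (Hc u))
    (fun u Hu => is_derive_opp _ u _ (Hd u Hu)) (fun _ _ => Rle_refl (- c))) as Hlo.
  lra.
Qed.

Lemma half_line_value_at_0 (f : R -> R) (c : R) :
  (forall u, continuous (fun z => f (Rmax 0 z)) u) ->
  (forall u, 0 < u -> f u = c) -> f 0 = c.
Proof.
  intros Hc Hf.
  enough (Hd : forall u, 0 < u -> is_derive f u 0).
  { pose proof (half_line_affine f 0 Hc Hd 1 Rle_0_1) as E; rewrite (Hf 1) in E; lra. }
  intros u Hu; apply (is_derive_ext_loc (fun _ => c)); [| apply (is_derive_const c)].
  generalize (open_gt 0 u Hu); apply filter_imp; intros y Hy.
  symmetry; apply Hf; lra.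
Qed.

Lemma is_filter_lim_half_line (t : R) : is_filter_lim (within half_line (locally t)) t.
Proof. intros P HP; apply filter_le_within, HP. Qed.

Lemma filterdiff_continuous_on_half_line {V : NormedModule R_AbsRing}
    (f : R -> V) (l : R -> R -> V) :
  (forall t, 0 <= t -> filterdiff f (within half_line (locally t)) (l t)) ->
  continuous_on half_line f.
Proof.
  intros H t Ht.
  apply (filterdiff_continuous_aux f); [exists (l t); apply H, Ht |].
  apply is_filter_lim_half_line.
Qed.

Section Curve.
Variables (g v : R -> R * R).
Hypothesis Hg : C1_curve half_line g v.

Lemma C1_derive_1 (t : R) : 0 < t -> is_derive (fun s => fst (g s)) t (fst (v t)).
Proof.
  intros Ht; pose proof (filterdiff_half_line_interior g _ t Ht
    (proj1 Hg t (Rlt_le _ _ Ht))) as H.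
  apply (filterdiff_comp g fst _ _ H (filterdiff_linear _ is_linear_fst)).
Qed.

Lemma C1_derive_2 (t : R) : 0 < t -> is_derive (fun s => snd (g s)) t (snd (v t)).
Proof.
  intros Ht; pose proof (filterdiff_half_line_interior g _ t Ht
    (proj1 Hg t (Rlt_le _ _ Ht))) as H.
  apply (filterdiff_comp g snd _ _ H (filterdiff_linear _ is_linear_snd)).
Qed.

Lemma C1_continuous (t : R) :
  continuous (fun s => fst (g (Rmax 0 s))) t /\
  continuous (fun s => snd (g (Rmax 0 s))) t /\
  continuous (fun s => fst (v (Rmax 0 s))) t /\
  continuous (fun s => snd (v (Rmax 0 s))) t.
Proof.
  assert (Hgc : continuous (fun s => g (Rmax 0 s)) t).
  { apply (continuous_on_half_line_extend g).
    apply (filterdiff_continuous_on_half_line g _ (proj1 Hg)). }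
  assert (Hvc : continuous (fun s => v (Rmax 0 s)) t)
    by apply (continuous_on_half_line_extend v), (proj2 Hg).
  repeat split.
  - apply (continuous_comp _ fst), continuous_fst; exact Hgc.
  - apply (continuous_comp _ snd), continuous_snd; exact Hgc.
  - apply (continuous_comp _ fst), continuous_fst; exact Hvc.
  - apply (continuous_comp _ snd), continuous_snd; exact Hvc.
Qed.

End Curve.

Lemma is_derive_pair (f1 f2 : R -> R) (t l1 l2 : R) :
  is_derive f1 t l1 -> is_derive f2 t l2 ->
  filterdiff (fun s => (f1 s, f2 s)) (locally t) (fun s => scal s (l1, l2)).
Proof.
  intros H1 H2.
  pose proof (filterdiff_comp_2 f1 f2 (fun a b : R => (a, b)) _ _ (fun a b => (a, b)) H1 H2)
   as H.
  apply H.
  apply (filterdiff_ext (fun p : R * R => p)); [now intros [a b] |].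
  apply (filterdiff_ext_lin _ (fun p : R * R => p)); [| now intros [a b]].
  apply filterdiff_id.
Qed.

Lemma C1_curve_of_derive (D : R -> Prop) (x1 x2 v1 v2 : R -> R) :
  (forall t, D t -> is_derive x1 t (v1 t)) ->
  (forall t, D t -> is_derive x2 t (v2 t)) ->
  (forall t, D t -> continuous v1 t) -> (forall t, D t -> continuous v2 t) ->
  C1_curve D (fun t => (x1 t, x2 t)) (fun t => (v1 t, v2 t)).
Proof.
  intros H1 H2 C1 C2; split.
  - intros t Ht; apply (filterdiff_within D _ _ t Ht), is_derive_pair; auto.
  - intros t Ht; apply (filterlim_filter_le_1 (F := locally t));
      [apply filter_le_within; apply locally_filter |].
    apply (filterlim_comp_2 (G := locally (v1 t)) (H := locally (v2 t)) v1 v2 pair);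
      [apply C1, Ht | apply C2, Ht |].
    intros P [d Hd]; exists (fun a => ball (v1 t) d a) (fun b => ball (v2 t) d b);
      [now exists d | now exists d |].
    intros a b Ha Hb; apply Hd; split; assumption.
Qed.

(** * Slopes, Lipschitz bounds and primitives *)

Lemma continuous_locally_neq0 (f : R -> R) (u : R) :
  continuous f u -> f u <> 0 -> locally u (fun z => f z <> 0).
Proof. intros Hc Hu; exact (Hc _ (open_neq 0 (f u) Hu)). Qed.

(** Caratheodory's form of differentiability: the slope from [t] extends continuously
    to [t].  With [is_derive_of_slope] it differentiates signed roots, and products
    with a merely continuous factor at a zero of the other factor. *)
Lemma slope_continuous (f : R -> R) (t l : R) :
  is_derive f t l ->
  exists q : R -> R, continuous q t /\ q t = l /\ forall s, f s = f t + q s * (s - t).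
Proof.
  intros Hd; apply is_derive_Reals in Hd.
  exists (fun s => if Req_EM_T s t then l else (f s - f t) / (s - t)).
  split; [| split].
  - apply continuity_pt_filterlim; intros eps Heps.
    destruct (Hd eps Heps) as [d Hdel].
    exists d; split; [apply cond_pos |]; intros s [_ Hs].
    simpl in *; unfold Rdist in *.
    destruct (Req_EM_T t t) as [_ | n]; [| now contradiction n].
    destruct (Req_EM_T s t) as [-> | Hst]; [rewrite Rminus_diag, Rabs_R0; exact Heps |].
    pose proof (Hdel (s - t) ltac:(lra) Hs) as H.
    replace (t + (s - t)) with s in H by ring; exact H.
  - destruct (Req_EM_T t t) as [_ | n]; [reflexivity | now contradiction n].
  - intros s; destruct (Req_EM_T s t) as [-> | Hst]; [ring | field; lra].
Qed.

Lemma is_derive_of_slope (f q : R -> R) (t : R) :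
  continuous q t -> locally t (fun s => f s = f t + q s * (s - t)) -> is_derive f t (q t).
Proof.
  intros Hc [d0 Hf]; apply is_derive_Reals; intros eps Heps.
  apply continuity_pt_filterlim in Hc.
  destruct (Hc eps Heps) as [d [Hd Hq]].
  assert (Hm : 0 < Rmin d d0) by (apply Rmin_pos; [exact Hd | apply cond_pos]).
  exists (mkposreal _ Hm); intros h Hh Hlt; simpl in Hlt.
  assert (Hb : ball t d0 (t + h)).
  { unfold ball; simpl; unfold AbsRing_ball, abs, minus, plus, opp; simpl.
    replace (t + h + - t) with h by ring.
    apply Rlt_le_trans with (1 := Hlt), Rmin_r. }
  rewrite (Hf _ Hb).
  replace ((f t + q (t + h) * (t + h - t) - f t) / h) with (q (t + h)) by (field; exact Hh).
  apply (Hq (t + h)); split; [split; [exact I | intros E; apply Hh; lra] |].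
  simpl; unfold Rdist; replace (t + h - t) with h by ring.
  apply Rlt_le_trans with (1 := Hlt), Rmin_l.
Qed.

(** If the square of [la] has derivative [2 la] then [la] has derivative 1, even though
    only continuity of [la] is known: divide the slope of the square by
    [la s + la t]. *)
Lemma is_derive_signed_root (la : R -> R) (t : R) :
  continuous la t -> la t <> 0 ->
  is_derive (fun s => la s ^ 2) t (2 * la t) -> is_derive la t 1.
Proof.
  intros Hc H0 Hd; destruct (slope_continuous _ _ _ Hd) as [q [Hq [Hqt Hs]]].
  assert (Hcs : continuous (fun s => la s + la t) t)
    by (apply (continuous_plus la (fun _ => la t)); [exact Hc | apply continuous_const]).
  assert (H2 : la t + la t <> 0) by lra.
  replace 1 with (q t / (la t + la t)) by (rewrite Hqt; field; lra).
  apply (is_derive_of_slope la (fun s => q s / (la s + la t))).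
  - apply (continuous_mult q (fun s => / (la s + la t))); [exact Hq |].
    apply (continuous_Rinv_comp (fun s => la s + la t)); assumption.
  - generalize (continuous_locally_neq0 _ _ Hcs H2); apply filter_imp; intros s Hne.
    apply (Rmult_eq_reg_r (la s + la t)); [| exact Hne].
    transitivity (la t * (la s + la t) + (la s ^ 2 - la t ^ 2)); [ring |].
    rewrite (Hs s); field; exact Hne.
Qed.

Lemma lipschitz_continuous (f : R -> R) (B L t : R) :
  (forall x y, Rabs x <= B -> Rabs y <= B -> Rabs (f x - f y) <= L * Rabs (x - y)) ->
  Rabs t < B -> continuous f t.
Proof.
  intros Hf Ht; apply continuity_pt_filterlim; intros eps Heps.
  set (L' := Rabs L + 1).
  assert (HL : 0 < L') by (unfold L'; pose proof (Rabs_pos L); lra).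
  exists (Rmin (eps / L') (B - Rabs t)); split.
  { apply Rmin_pos; [apply Rdiv_lt_0_compat; lra | lra]. }
  intros s [_ Hs]; simpl in *; unfold Rdist in *.
  assert (Hs1 : Rabs (s - t) < eps / L') by (eapply Rlt_le_trans; [exact Hs | apply Rmin_l]).
  assert (Hs2 : Rabs (s - t) < B - Rabs t) by (eapply Rlt_le_trans; [exact Hs | apply Rmin_r]).
  assert (HsB : Rabs s <= B).
  { replace s with ((s - t) + t) by ring. pose proof (Rabs_triang (s - t) t); lra. }
  apply Rle_lt_trans with (1 := Hf s t HsB (Rlt_le _ _ Ht)).
  apply Rle_lt_trans with (L' * Rabs (s - t)).
  - apply Rmult_le_compat_r; [apply Rabs_pos |].
    unfold L'; pose proof (RRle_abs L); lra.
  - apply (Rmult_lt_compat_l L') in Hs1; [| exact HL].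
    replace (L' * (eps / L')) with eps in Hs1 by (field; lra); exact Hs1.
Qed.

Lemma short_continuous (f : R -> R) (t : R) :
  (forall x y, Rabs (f x - f y) <= Rabs (x - y)) -> continuous f t.
Proof.
  intros Hf; apply (lipschitz_continuous f (Rabs t + 1) 1); [| lra].
  intros x y _ _; rewrite Rmult_1_l; apply Hf.
Qed.

Lemma lipschitz_of_derive (f df : R -> R) (I : R -> Prop) (L : R) :
  (forall x y z, I x -> I y -> x <= z <= y -> I z) ->
  (forall x, I x -> is_derive f x (df x)) -> (forall x, I x -> Rabs (df x) <= L) ->
  forall x y, I x -> I y -> Rabs (f x - f y) <= L * Rabs (x - y).
Proof.
  intros HI Hd HL x y Hx Hy.
  assert (Hin : forall z, Rmin y x <= z <= Rmax y x -> I z).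
  { intros z; unfold Rmin, Rmax; destruct (Rle_dec y x); intros Hz; eauto. }
  destruct (MVT_gen f y x df) as [z [Hz E]].
  - intros z Hz; apply Hd, Hin; lra.
  - intros z Hz; apply continuity_pt_filterlim.
    apply (ex_derive_continuous f); eexists; apply Hd, Hin, Hz.
  - rewrite E, Rabs_mult; apply Rmult_le_compat_r; [apply Rabs_pos | apply HL, Hin, Hz].
Qed.

Lemma is_derive_integral (f : R -> R) (t : R) :
  (forall s, continuous f s) -> is_derive (fun z => RInt f 0 z) t (f t).
Proof.
  intros Hf; apply (is_derive_RInt f (fun z => RInt f 0 z) 0 t); [| apply Hf].
  apply filter_forall; intros s; apply (RInt_correct f), (ex_RInt_continuous f).
  intros; apply Hf.
Qed.

Lemma unbounded_primitive (k : R -> R) (e : R) :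
  (forall t, continuous k t) -> 0 < e -> (forall t, e <= k t) ->
  exists W : R -> R, W 0 = 0 /\ (forall t, is_derive W t (k t)) /\
    forall y, 0 <= y -> exists t, 0 <= t /\ W t = y.
Proof.
  intros Hk He Hke; exists (fun t => RInt k 0 t).
  assert (E0 : RInt k 0 0 = 0) by apply (RInt_point 0 k).
  assert (Hd : forall t, is_derive (fun t => RInt k 0 t) t (k t)).
  { intros t; apply is_derive_integral, Hk. }
  split; [exact E0 |]; split; [exact Hd |]; intros y Hy.
  assert (Hye : 0 <= y / e) by (apply Rdiv_le_0_compat; assumption).
  assert (Hbig : y <= RInt k 0 (y / e)).
  { replace y with (RInt (fun _ => e) 0 (y / e)) at 1.
    - apply RInt_le; [exact Hye | apply ex_RInt_const | | intros; apply Hke].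
      apply (ex_RInt_continuous k); intros; apply Hk.
    - rewrite RInt_const; unfold scal; simpl; unfold mult; simpl; field; lra. }
  destruct (IVT_gen (fun t => RInt k 0 t) 0 (y / e) y) as [t [Ht E]].
  - intros t; apply continuity_pt_filterlim.
    apply (ex_derive_continuous (fun t => RInt k 0 t)); eexists; apply Hd.
  - rewrite E0, Rmin_left, Rmax_right by lra; lra.
  - exists t; split; [| exact E]; rewrite Rmin_left in Ht by exact Hye; lra.
Qed.

(** * A second-order equation with bounded speed *)

(** In the norm of weight [exp (- K |t|)], integration from 0 contracts by [1 / K]. *)
Lemma RInt_exp_bound_pos (f : R -> R) (D K t : R) :
  (forall w, continuous f w) -> 0 < K -> 0 <= t ->
  (forall w, 0 <= w <= t -> Rabs (f w) <= D * exp (K * w)) ->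
  Rabs (RInt f 0 t) <= D / K * exp (K * t).
Proof.
  intros Hf HK Ht Hb.
  assert (Hi : forall a b, ex_RInt f a b) by (intros; apply (ex_RInt_continuous f); auto).
  assert (HD : 0 <= D).
  { pose proof (Hb 0 (conj (Rle_refl 0) Ht)) as H.
    rewrite Rmult_0_r, exp_0, Rmult_1_r in H; pose proof (Rabs_pos (f 0)); lra. }
  assert (HE : is_RInt (fun w => D * exp (K * w)) 0 t (D / K * exp (K * t) - D / K * exp (K * 0))).
  { apply (is_RInt_derive (fun w => D / K * exp (K * w))).
    - intros x _; auto_derive; [exact I | field; lra].
    - intros x _; apply (ex_derive_continuous (fun w => D * exp (K * w))); auto_derive; exact I. }
  apply Rle_trans with (RInt (fun w => Rabs (f w)) 0 t).
  { apply abs_RInt_le; [exact Ht | apply Hi]. }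
  apply Rle_trans with (D / K * exp (K * t) - D / K * exp (K * 0)).
  - rewrite <- (is_RInt_unique _ _ _ _ HE); apply RInt_le; [exact Ht | | eexists; exact HE |].
    + apply (ex_RInt_continuous (fun w => Rabs (f w))); intros w _.
      apply (continuous_comp f Rabs), continuous_Rabs; apply Hf.
    + intros w Hw; apply Hb; lra.
  - rewrite Rmult_0_r, exp_0.
    assert (0 <= D / K) by (apply Rdiv_le_0_compat; assumption); lra.
Qed.

Lemma RInt_exp_bound (f : R -> R) (D K t : R) :
  (forall w, continuous f w) -> 0 < K ->
  (forall w, Rabs w <= Rabs t -> Rabs (f w) <= D * exp (K * Rabs w)) ->
  Rabs (RInt f 0 t) <= D / K * exp (K * Rabs t).
Proof.
  intros Hf HK Hb; destruct (Rle_lt_dec 0 t) as [Ht | Ht].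
  - rewrite (Rabs_pos_eq t Ht) in *; apply RInt_exp_bound_pos; try assumption.
    intros w Hw; pose proof (Hb w) as H; rewrite Rabs_pos_eq in H by lra; apply H; lra.
  - rewrite (Rabs_left t Ht) in *.
    assert (Hi : ex_RInt f (- 0) (- - t)) by (apply (ex_RInt_continuous f); auto).
    pose proof (is_RInt_unique _ _ _ _
      (is_RInt_comp_opp f 0 (- t) _ (RInt_correct f _ _ Hi))) as E.
    rewrite Ropp_0, Ropp_involutive in E; rewrite <- E.
    apply RInt_exp_bound_pos; [| exact HK | lra |].
    + intros w; apply (continuous_opp (fun y => f (- y))).
      apply (continuous_comp Ropp f); [| apply Hf].
      apply (continuous_opp (fun y : R => y)), continuous_id.
    + intros w Hw; unfold opp; simpl; rewrite Rabs_Ropp.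
      pose proof (Hb (- w)) as H; rewrite Rabs_Ropp, Rabs_pos_eq in H by lra; apply H; lra.
Qed.

Lemma geometric_limit (u : nat -> R) (C : R) :
  (forall n, Rabs (u (S n) - u n) <= C * (1 / 2) ^ n) ->
  forall n, Rabs (u n - real (Lim_seq u)) <= 2 * C * (1 / 2) ^ n.
Proof.
  intros Hu.
  assert (HC : 0 <= C).
  { pose proof (Hu O) as H; simpl in H; pose proof (Rabs_pos (u 1%nat - u O)); lra. }
  assert (Hpos : forall n, 0 < (1 / 2) ^ n) by (intros; apply pow_lt; lra).
  assert (Hk : forall n k, Rabs (u (n + k)%nat - u n)
                <= 2 * C * (1 / 2) ^ n * (1 - (1 / 2) ^ k)).
  { intros n; induction k as [| k IH].
    - rewrite Nat.add_0_r, Rminus_diag, Rabs_R0; simpl; lra.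
    - rewrite Nat.add_succ_r.
      replace (u (S (n + k)) - u n)
        with ((u (S (n + k)) - u (n + k)%nat) + (u (n + k)%nat - u n)) by ring.
      apply Rle_trans with (1 := Rabs_triang _ _).
      pose proof (Hu (n + k)%nat) as H; rewrite pow_add in H; simpl; lra. }
  assert (Hk' : forall n k, Rabs (u (n + k)%nat - u n) <= 2 * C * (1 / 2) ^ n).
  { intros n k; apply Rle_trans with (1 := Hk n k).
    rewrite <- (Rmult_1_r (2 * C * (1 / 2) ^ n)) at 2.
    apply Rmult_le_compat_l; [| pose proof (Hpos k); lra].
    apply Rmult_le_pos; [lra | left; apply Hpos]. }
  assert (Hlim : ex_finite_lim_seq u).
  { apply ex_lim_seq_cauchy_corr; intros eps.
    assert (He : 0 < eps / (4 * C + 1)) by (apply Rdiv_lt_0_compat; [apply cond_pos | lra]).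
    destruct (pow_lt_1_zero (1 / 2) ltac:(rewrite Rabs_pos_eq; lra) _ He) as [N HN].
    assert (HN' : 4 * C * (1 / 2) ^ N < eps).
    { pose proof (HN N (le_n N)) as H; rewrite Rabs_pos_eq in H by (left; apply Hpos).
      apply (Rmult_lt_compat_l (4 * C + 1)) in H; [| lra].
      replace ((4 * C + 1) * (eps / (4 * C + 1))) with (pos eps) in H by (field; lra).
      pose proof (Hpos N); nra. }
    exists N; intros n k Hn Hkn.
    replace n with (N + (n - N))%nat by lia; replace k with (N + (k - N))%nat by lia.
    pose proof (Hk' N (n - N)%nat) as A1; pose proof (Hk' N (k - N)%nat) as A2.
    replace (_ - _) with ((u (N + (n - N))%nat - u N) + - (u (N + (k - N))%nat - u N)) by ring.
    apply Rle_lt_trans with (1 := Rabs_triang _ _); rewrite Rabs_Ropp; lra. }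
  intros n; apply Lim_seq_correct' in Hlim.
  apply (is_lim_seq_incr_n u n) in Hlim.
  rewrite Rabs_minus_sym.
  pose proof (is_lim_seq_abs _ _ (is_lim_seq_minus' _ _ _ _ Hlim (is_lim_seq_const (u n)))) as Ha.
  apply (is_lim_seq_le (fun k => Rabs (u (k + n)%nat - u n)) (fun _ => 2 * C * (1 / 2) ^ n)
           (Rabs (real (Lim_seq u) - u n)) (2 * C * (1 / 2) ^ n)).
  - intros k; rewrite Nat.add_comm; apply Hk'.
  - exact Ha.
  - apply is_lim_seq_const.
Qed.

Lemma le_of_geometric (x y C : R) :
  (forall n, x <= y + C * (1 / 2) ^ n) -> x <= y.
Proof.
  intros H.
  apply (is_lim_seq_le (fun _ => x) (fun n => y + C * (1 / 2) ^ n) x y H (is_lim_seq_const x)).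
  replace (Finite y) with (Finite (y + C * 0)) by (f_equal; ring).
  apply is_lim_seq_plus'; [apply is_lim_seq_const |].
  apply is_lim_seq_mult'; [apply is_lim_seq_const |].
  apply is_lim_seq_geom; rewrite Rabs_pos_eq; lra.
Qed.

Section Picard.
Variables (f c : R -> R) (r0 : R).
Hypothesis Hc : forall x y, Rabs (c x - c y) <= Rabs (x - y).
Hypothesis Hc1 : forall x, Rabs (c x) <= 1.
Hypothesis Hf : forall B, exists L, forall x y,
  Rabs x <= B -> Rabs y <= B -> Rabs (f x - f y) <= L * Rabs (x - y).

Definition momentum_of (y : R -> R) (t : R) : R := RInt (fun w => f (y w)) 0 t.

(** The equation [r' = c(p)], [p' = f(r)], with [p(0) = 0], as a fixed point problem
    for [r] alone. *)
Definition picard_step (y : R -> R) (t : R) : R :=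
  r0 + RInt (fun u => c (momentum_of y u)) 0 t.

Fixpoint picard (n : nat) : R -> R :=
  match n with O => fun _ => r0 | S n => picard_step (picard n) end.

(** All iterates stay in this class because [|c| <= 1].  It keeps them in a fixed
    compact set on each bounded time interval, where [f] is Lipschitz, and it passes to
    pointwise limits. *)
Definition short_from (y : R -> R) : Prop :=
  y 0 = r0 /\ forall s t, Rabs (y s - y t) <= Rabs (s - t).

Lemma force_continuous (t : R) : continuous f t.
Proof.
  destruct (Hf (Rabs t + 1)) as [L HL].
  apply (lipschitz_continuous f (Rabs t + 1) L); [exact HL | lra].
Qed.

Lemma is_derive_momentum_of (y : R -> R) (t : R) :
  short_from y -> is_derive (momentum_of y) t (f (y t)).
Proof.
  intros [_ Hy]; apply (is_derive_integral (fun w => f (y w))); intros s.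
  apply (continuous_comp y f); [apply short_continuous, Hy | apply force_continuous].
Qed.

Lemma picard_integrand_continuous (y : R -> R) (t : R) :
  short_from y -> continuous (fun u => c (momentum_of y u)) t.
Proof.
  intros Hy; apply (continuous_comp (momentum_of y) c).
  - apply (ex_derive_continuous (momentum_of y)); eexists; apply is_derive_momentum_of, Hy.
  - apply short_continuous, Hc.
Qed.

Lemma is_derive_picard_step (y : R -> R) (t : R) :
  short_from y -> is_derive (picard_step y) t (c (momentum_of y t)).
Proof.
  intros Hy; unfold picard_step.
  replace (c (momentum_of y t)) with (0 + c (momentum_of y t)) by ring.
  apply (is_derive_plus (fun _ => r0)); [apply (is_derive_const r0) |].
  apply (is_derive_integral (fun u => c (momentum_of y u))).
  intros s; apply picard_integrand_continuous, Hy.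
Qed.

Lemma picard_step_short (y : R -> R) : short_from y -> short_from (picard_step y).
Proof.
  intros Hy; split; [unfold picard_step; rewrite RInt_point; apply Rplus_0_r |].
  assert (Hi : forall a b, ex_RInt (fun u => c (momentum_of y u)) a b).
  { intros; apply (ex_RInt_continuous (fun u => c (momentum_of y u))); intros.
    apply picard_integrand_continuous, Hy. }
  assert (Hle : forall s t, s <= t -> Rabs (picard_step y t - picard_step y s) <= t - s).
  { intros s t Hst; unfold picard_step.
    set (k := fun u => c (momentum_of y u)) in *.
    assert (E : RInt k 0 s + RInt k s t = RInt k 0 t)
      by exact (RInt_Chasles k 0 s t (Hi 0 s) (Hi s t)).
    replace (r0 + RInt k 0 t - (r0 + RInt k 0 s)) with (RInt k s t) by lra.
    rewrite <- (Rmult_1_r (t - s)); apply abs_RInt_le_const; auto.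
    intros u _; apply Hc1. }
  intros s t; destruct (Rle_lt_dec s t) as [H | H].
  - rewrite Rabs_minus_sym, (Rabs_minus_sym s), (Rabs_pos_eq (t - s)) by lra; auto.
  - rewrite (Rabs_pos_eq (s - t)) by lra; apply Hle; lra.
Qed.

Lemma picard_short (n : nat) : short_from (picard n).
Proof.
  induction n as [| n IH]; [| apply picard_step_short, IH].
  split; [reflexivity |]; intros s t; simpl; rewrite Rminus_diag, Rabs_R0; apply Rabs_pos.
Qed.

(** In the weighted norm of [RInt_exp_bound] the two integrations in a step outweigh
    the Lipschitz constant of [f] once the weight is large. *)
Lemma picard_step_contraction (T : R) :
  exists K, 0 < K /\ forall (y z : R -> R) (D : R),
    short_from y -> short_from z ->
    (forall w, Rabs w <= T -> Rabs (y w - z w) <= D * exp (K * Rabs w)) ->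
    forall t, Rabs t <= T ->
    Rabs (picard_step y t - picard_step z t) <= D * (1 / 2) * exp (K * Rabs t).
Proof.
  destruct (Hf (Rabs r0 + T)) as [L0 HL0].
  set (L := Rabs L0); assert (HL : 0 <= L) by apply Rabs_pos.
  (* Each integration gains a factor [1 / (L + 2)], and
     [L / (L + 2) ^ 2 <= 1 / 2]. *)
  exists (L + 2); split; [lra |]; intros y z D Hy Hz HD.
  assert (Hball : forall q w, short_from q -> Rabs w <= T -> Rabs (q w) <= Rabs r0 + T).
  { intros q w [Hq0 Hq] Hw; pose proof (Hq w 0) as H; rewrite Hq0, Rminus_0_r in H.
    replace (q w) with (r0 + (q w - r0)) by ring.
    apply Rle_trans with (1 := Rabs_triang _ _); lra. }
  assert (Hcy : forall q w, short_from q -> continuous (fun v => f (q v)) w).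
  { intros q w [_ Hq]; apply (continuous_comp q f);
      [apply short_continuous, Hq | apply force_continuous]. }
  assert (Hm : forall u, Rabs u <= T ->
    Rabs (momentum_of y u - momentum_of z u) <= L * D / (L + 2) * exp ((L + 2) * Rabs u)).
  { intros u Hu; unfold momentum_of.
    replace (_ - _) with (RInt (fun w => f (y w) - f (z w)) 0 u).
    2: { apply (RInt_minus (fun w => f (y w)) (fun w => f (z w)));
           [apply (ex_RInt_continuous (fun w => f (y w)))
           | apply (ex_RInt_continuous (fun w => f (z w)))];
           intros; apply Hcy; assumption. }
    apply RInt_exp_bound; [| lra |].
    - intros w; apply (continuous_minus (fun w => f (y w)) (fun w => f (z w)));
        apply Hcy; assumption.
    - intros w Hw; rewrite Rmult_assoc.
      apply Rle_trans with (L * Rabs (y w - z w)).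
      + apply Rle_trans with (L0 * Rabs (y w - z w)).
        * apply HL0; apply Hball; try assumption; lra.
        * apply Rmult_le_compat_r; [apply Rabs_pos | apply RRle_abs].
      + apply Rmult_le_compat_l; [exact HL | apply HD; lra]. }
  intros t Ht; unfold picard_step.
  replace (_ - _) with
    (RInt (fun u => c (momentum_of y u) - c (momentum_of z u)) 0 t).
  2: { rewrite (RInt_minus (fun u => c (momentum_of y u)) (fun u => c (momentum_of z u)));
         [unfold minus, plus, opp; simpl; ring | |];
         [apply (ex_RInt_continuous (fun u => c (momentum_of y u)))
         | apply (ex_RInt_continuous (fun u => c (momentum_of z u)))];
         intros; apply picard_integrand_continuous; assumption. }
  apply Rle_trans with (L * D / (L + 2) / (L + 2) * exp ((L + 2) * Rabs t)).
  - apply RInt_exp_bound; [| lra |].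
    + intros w; apply (continuous_minus (fun u => c (momentum_of y u))
                                        (fun u => c (momentum_of z u)));
        apply picard_integrand_continuous; assumption.
    + intros w Hw; apply Rle_trans with (1 := Hc _ _); apply Hm; lra.
  - apply Rmult_le_compat_r; [left; apply exp_pos |].
    assert (HD0 : 0 <= D).
    { pose proof (HD 0) as H; rewrite Rabs_R0, Rmult_0_r, exp_0, Rmult_1_r in H.
      apply Rle_trans with (2 := H ltac:(pose proof (Rabs_pos t); lra)); apply Rabs_pos. }
    unfold Rdiv; rewrite Rmult_assoc, (Rmult_comm L D), Rmult_assoc.
    apply Rmult_le_compat_l; [exact HD0 |].
    rewrite Rmult_1_l, <- Rinv_mult.
    apply (Rmult_le_reg_r ((L + 2) * (L + 2))); [nra |].
    rewrite Rmult_assoc, Rinv_l by nra; nra.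
Qed.

Definition picard_limit (t : R) : R := real (Lim_seq (fun n => picard n t)).

(** The contraction statement is repeated in the conclusion because it must hold for
    the same weight [K] as the rate of convergence. *)
Lemma picard_limit_bound (T : R) :
  exists K C, 0 <= C /\ 0 < K /\
    (forall n t, Rabs t <= T ->
       Rabs (picard n t - picard_limit t) <= 2 * C * (1 / 2) ^ n * exp (K * Rabs t)) /\
    forall (y z : R -> R) (D : R), short_from y -> short_from z ->
    (forall w, Rabs w <= T -> Rabs (y w - z w) <= D * exp (K * Rabs w)) ->
    forall t, Rabs t <= T ->
    Rabs (picard_step y t - picard_step z t) <= D * (1 / 2) * exp (K * Rabs t).
Proof.
  destruct (picard_step_contraction T) as [K [HK Hstep]].
  exists K, (Rabs T); split; [apply Rabs_pos |]; split; [exact HK |].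
  split; [| exact Hstep].
  assert (Hn : forall n t, Rabs t <= T ->
    Rabs (picard (S n) t - picard n t) <= Rabs T * (1 / 2) ^ n * exp (K * Rabs t)).
  { induction n as [| n IH]; intros t Ht.
    - pose proof (proj2 (picard_short 1) t 0) as H; rewrite (proj1 (picard_short 1)) in H.
      simpl (picard 0 t); simpl pow; rewrite Rmult_1_r, Rminus_0_r in *.
      apply Rle_trans with (1 := H).
      assert (He : 1 <= exp (K * Rabs t)).
      { rewrite <- exp_0; destruct (Req_dec (K * Rabs t) 0) as [-> | Hne]; [lra |].
        left; apply exp_increasing. pose proof (Rabs_pos t).
        assert (0 <= K * Rabs t) by (apply Rmult_le_pos; lra); lra. }
      pose proof (RRle_abs T); pose proof (Rabs_pos T); nra.
    - simpl pow; rewrite (Rmult_comm (1 / 2)), <- Rmult_assoc.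
      apply (Hstep (picard (S n)) (picard n)); auto using picard_short. }
  intros n t Ht.
  replace (2 * Rabs T * (1 / 2) ^ n * exp (K * Rabs t))
    with (2 * (Rabs T * exp (K * Rabs t)) * (1 / 2) ^ n) by ring.
  apply (geometric_limit (fun n => picard n t)); intros k.
  replace (Rabs T * exp (K * Rabs t) * (1 / 2) ^ k)
    with (Rabs T * (1 / 2) ^ k * exp (K * Rabs t)) by ring; auto.
Qed.

Lemma picard_limit_short : short_from picard_limit.
Proof.
  split.
  - unfold picard_limit; rewrite (Lim_seq_ext _ (fun _ => r0)).
    + rewrite Lim_seq_const; reflexivity.
    + intros n; apply (picard_short n).
  - intros s t; set (T := Rmax (Rabs s) (Rabs t)).
    destruct (picard_limit_bound T) as [K [C [HC [HK [Hb _]]]]].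
    apply (le_of_geometric _ _ (2 * C * exp (K * Rabs s) + 2 * C * exp (K * Rabs t))).
    intros n; pose proof (Hb n s (Rmax_l _ _)) as Hs; pose proof (Hb n t (Rmax_r _ _)) as Ht.
    pose proof (proj2 (picard_short n) s t) as Hn.
    rewrite Rabs_minus_sym in Hs.
    replace (picard_limit s - picard_limit t)
      with ((picard_limit s - picard n s) + (picard n s - picard n t)
            + (picard n t - picard_limit t)) by ring.
    apply Rle_trans with (1 := Rabs_triang _ _).
    apply Rle_trans with (1 := Rplus_le_compat_r _ _ _ (Rabs_triang _ _)). lra.
Qed.

Lemma picard_limit_fixed (t : R) : picard_limit t = picard_step picard_limit t.
Proof.
  destruct (picard_limit_bound (Rabs t)) as [K [C [HC [HK [Hb Hstep]]]]].
  apply Rminus_diag_uniq.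
  assert (Hz : Rabs (picard_limit t - picard_step picard_limit t) <= 0).
  { apply (le_of_geometric _ _ (2 * C * exp (K * Rabs t))); intros n.
    pose proof (Hb (S n) t (Rle_refl _)) as H1.
    pose proof (Hstep (picard n) picard_limit _ (picard_short n) picard_limit_short
                  (fun w Hw => Hb n w Hw) t (Rle_refl _)) as H2.
    rewrite Rabs_minus_sym in H1; simpl pow in H1; simpl picard in H1.
    replace (picard_limit t - picard_step picard_limit t)
      with ((picard_limit t - picard_step (picard n) t)
            + (picard_step (picard n) t - picard_step picard_limit t)) by ring.
    apply Rle_trans with (1 := Rabs_triang _ _). lra. }
  pose proof (Rabs_pos (picard_limit t - picard_step picard_limit t)).
  destruct (Req_dec (picard_limit t - picard_step picard_limit t) 0) as [E | E]; [exact E |].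
  apply Rabs_pos_lt in E; lra.
Qed.

(** The bound on [c] excludes escape to infinity in finite time, so that a locally
    Lipschitz force is enough for a solution on the whole line. *)
Lemma bounded_speed_ode :
  exists r p : R -> R, r 0 = r0 /\ p 0 = 0 /\
    forall t, is_derive r t (c (p t)) /\ is_derive p t (f (r t)).
Proof.
  pose proof picard_limit_short as Hs.
  exists picard_limit, (momentum_of picard_limit).
  split; [apply Hs |]; split; [apply (RInt_point 0 (fun w => f (picard_limit w))) |].
  intros t; split.
  - apply (is_derive_ext (picard_step picard_limit));
      [intros; symmetry; apply picard_limit_fixed |].
    apply is_derive_picard_step, Hs.
  - apply is_derive_momentum_of, Hs.
Qed.

End Picard.

(** If [p] is the tangent of the angle between an h-unit vector and the parallel, this is
    its sine, the radial velocity. *)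
Definition slope_to_speed (p : R) : R := p / sqrt (1 + p ^ 2).

Lemma sqrt_1_plus_sqr (p : R) : 1 <= sqrt (1 + p ^ 2) /\ sqrt (1 + p ^ 2) ^ 2 = 1 + p ^ 2.
Proof.
  pose proof (pow2_ge_0 p); split; [| apply pow2_sqrt; lra].
  rewrite <- sqrt_1 at 1; apply sqrt_le_1_alt; lra.
Qed.

Lemma is_derive_sqrt_1_plus_sqr (p : R) :
  is_derive (fun q => sqrt (1 + q ^ 2)) p (slope_to_speed p).
Proof.
  destruct (sqrt_1_plus_sqr p) as [H1 H2]; unfold slope_to_speed.
  auto_derive; [simpl in H2; nra | simpl in *; field; lra].
Qed.

Lemma is_derive_slope_to_speed (p : R) :
  is_derive slope_to_speed p (/ sqrt (1 + p ^ 2) ^ 3).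
Proof.
  destruct (sqrt_1_plus_sqr p) as [H1 H2]; unfold slope_to_speed.
  pose proof (is_derive_div (fun z => z) (fun z => sqrt (1 + z ^ 2)) p 1 _
    (is_derive_id p) (is_derive_sqrt_1_plus_sqr p) ltac:(lra)) as D.
  match type of D with is_derive _ _ ?l => replace (/ _) with l; [exact D |] end.
  unfold slope_to_speed; set (q := sqrt (1 + p ^ 2)) in *.
  transitivity ((q ^ 2 - p ^ 2) / q ^ 3); [field; lra |].
  rewrite H2; field; lra.
Qed.

Lemma slope_to_speed_bound (p : R) : Rabs (slope_to_speed p) <= 1.
Proof.
  destruct (sqrt_1_plus_sqr p) as [H1 H2]; unfold slope_to_speed.
  unfold Rdiv; rewrite Rabs_mult, Rabs_inv, (Rabs_pos_eq (sqrt _)) by lra.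
  apply Rle_div_l; [lra |]; rewrite Rmult_1_l.
  apply Rsqr_incr_0_var; [| lra].
  rewrite !Rsqr_pow2, pow2_abs; lra.
Qed.

Lemma slope_to_speed_short (x y : R) :
  Rabs (slope_to_speed x - slope_to_speed y) <= Rabs (x - y).
Proof.
  rewrite <- (Rmult_1_l (Rabs (x - y))).
  apply (lipschitz_of_derive _ (fun p => / sqrt (1 + p ^ 2) ^ 3) (fun _ => True)); auto.
  - intros z _; apply is_derive_slope_to_speed.
  - intros z _; destruct (sqrt_1_plus_sqr z) as [H1 _].
    assert (1 <= sqrt (1 + z ^ 2) ^ 3) by (apply pow_R1_Rle; exact H1).
    rewrite Rabs_pos_eq; [| left; apply Rinv_0_lt_compat; lra].
    apply Rle_trans with (/ 1); [apply Rinv_le_contravar; lra | rewrite Rinv_1; lra].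
Qed.

(** * Unit vectors and the Euler-Lagrange derivatives *)

Section Surface.
Variables (m : R -> R) (mu : R).
Hypothesis Hm : warping_function m.
Hypothesis Hmu : 0 < mu.
Hypothesis Hbound : forall r : R, 0 <= r -> m r < 1 / mu.

Lemma warping_nonneg (r : R) : 0 <= r -> 0 <= m r.
Proof.
  intros [Hr | <-]; [left; apply (warping_pos m Hm r Hr) |].
  rewrite (warping_0 m Hm); lra.
Qed.

Lemma wind_subunit (r : R) : 0 <= r -> mu ^ 2 * m r ^ 2 < 1.
Proof.
  intros Hr; pose proof (warping_nonneg r Hr); pose proof (Hbound r Hr) as Hb.
  apply (Rmult_lt_compat_r mu) in Hb; [| exact Hmu].
  replace (1 / mu * mu) with 1 in Hb by (field; lra).
  replace (mu ^ 2 * m r ^ 2) with ((m r * mu) ^ 2) by ring.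
  assert (0 <= m r * mu) by (apply Rmult_le_pos; lra). nra.
Qed.

Lemma is_derive_warping (r : R) : is_derive m r (Derive m r).
Proof. apply Derive_correct, (warping_smooth m Hm 1 r). Qed.

(** The Clairaut constant: the h-product of [d/dtheta] and of the vector freed from the
    wind. *)
Definition angular_momentum (x y : R * R) : R :=
  m (radius x) ^ 2 * (dtheta x y - mu).

Lemma unit_vector_polar (x y : R * R) :
  radius x <> 0 ->
  randers m mu x y = 1 <->
  dr x y ^ 2 + m (radius x) ^ 2 * (dtheta x y - mu) ^ 2 = 1.
Proof.
  intros Hx; rewrite (randers_polar m mu x y Hx).
  apply polar_speed_eq1; [apply pow2_ge_0 | apply wind_subunit, radius_nonneg].
Qed.

Lemma momentum_scale_pos (x y : R * R) :
  radius x <> 0 -> randers m mu x y = 1 -> 0 < 1 + mu * angular_momentum x y.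
Proof.
  intros Hx H1; apply (momentum_factor_pos mu (m (radius x) ^ 2) (pow2_ge_0 _)
    (wind_subunit _ (radius_nonneg x)) (dr x y)).
  apply Req_le, unit_vector_polar; assumption.
Qed.

(** Chain rule for the energy in the polar quantities, along a curve [(p, q)] in the
    tangent bundle; the four partial derivatives below are its special cases. *)
Lemma Derive_energy_line (p q : R -> R * R) (u : R) (dR da db : R) :
  radius (p u) <> 0 -> randers m mu (p u) (q u) = 1 ->
  is_derive (fun z => radius (p z)) u dR ->
  is_derive (fun z => dr (p z) (q z)) u da ->
  is_derive (fun z => dtheta (p z) (q z)) u db ->
  Derive (fun z => energy m mu (p z) (q z)) u =
  (dr (p u) (q u) * da + angular_momentum (p u) (q u) * db
   + (dtheta (p u) (q u) - mu) ^ 2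
     * (m (radius (p u)) * Derive m (radius (p u)) * dR))
  / (1 + mu * angular_momentum (p u) (q u)).
Proof.
  intros Hx H1 HR Ha Hb; apply is_derive_unique.
  apply (is_derive_ext_loc (fun z =>
    polar_speed mu (m (radius (p z)) ^ 2) (dr (p z) (q z)) (dtheta (p z) (q z)) ^ 2 / 2)).
  { assert (Hc : continuous (fun z => radius (p z)) u)
      by (apply (ex_derive_continuous (fun z => radius (p z))); eexists; exact HR).
    generalize (continuous_locally_neq0 _ _ Hc Hx); apply filter_imp; intros z Hz.
    unfold energy; rewrite randers_polar by exact Hz; reflexivity. }
  assert (HM : is_derive (fun z => m (radius (p z)) ^ 2) u
                 (2 * (m (radius (p u)) * Derive m (radius (p u)) * dR))).
  { pose proof (is_derive_comp m (fun z => radius (p z)) u _ _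
      (is_derive_warping _) HR) as Hc.
    pose proof (is_derive_pow (fun z => m (radius (p z))) 2 u _ Hc) as Hp.
    match type of Hp with is_derive _ _ ?l => replace (2 * _) with l; [exact Hp |] end.
    unfold scal; simpl; unfold mult; simpl; ring. }
  pose proof (is_derive_polar_speed mu (fun z => m (radius (p z)) ^ 2)
    (fun z => dr (p z) (q z)) (fun z => dtheta (p z) (q z)) u _ _ _
    (pow2_ge_0 _) (wind_subunit _ (radius_nonneg _))
    (proj1 (unit_vector_polar _ _ Hx) H1) HM Ha Hb) as H.
  match type of H with is_derive _ _ ?l =>
    match goal with |- is_derive _ _ ?l' => replace l' with l; [exact H |] end end.
  unfold angular_momentum; f_equal; f_equal; field.
Qed.

Lemma energy_y1_eq (x y : R * R) :
  radius x <> 0 -> randers m mu x y = 1 ->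
  energy_y1 m mu x y =
  (dr x y * fst x / radius x - angular_momentum x y * snd x / radius x ^ 2)
  / (1 + mu * angular_momentum x y).
Proof.
  destruct x as [x1 x2], y as [y1 y2]; intros Hx H1.
  set (x := (x1, x2)) in *; set (y := (y1, y2)) in *; set (rho := radius x) in *.
  set (a := dr x y); set (b := dtheta x y); set (nu := angular_momentum x y).
  unfold energy_y1; simpl snd; simpl fst.
  rewrite (Derive_energy_line (fun _ => x) (fun u => (u, y2)) y1
    0 (x1 / rho) (- x2 / rho ^ 2) Hx H1).
  - cbv beta; fold y; fold rho; fold a; fold nu; unfold Rdiv; ring.
  - apply (is_derive_const (radius x)).
  - unfold dr; simpl; fold rho; auto_derive; [exact I | field; exact Hx].
  - unfold dtheta; simpl; fold rho; auto_derive; [exact I | field; exact Hx].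
Qed.

Lemma energy_y2_eq (x y : R * R) :
  radius x <> 0 -> randers m mu x y = 1 ->
  energy_y2 m mu x y =
  (dr x y * snd x / radius x + angular_momentum x y * fst x / radius x ^ 2)
  / (1 + mu * angular_momentum x y).
Proof.
  destruct x as [x1 x2], y as [y1 y2]; intros Hx H1.
  set (x := (x1, x2)) in *; set (y := (y1, y2)) in *; set (rho := radius x) in *.
  set (a := dr x y); set (b := dtheta x y); set (nu := angular_momentum x y).
  unfold energy_y2; simpl snd; simpl fst.
  rewrite (Derive_energy_line (fun _ => x) (fun u => (y1, u)) y2
    0 (x2 / rho) (x1 / rho ^ 2) Hx H1).
  - cbv beta; fold y; fold rho; fold a; fold nu; unfold Rdiv; ring.
  - apply (is_derive_const (radius x)).
  - unfold dr; simpl; fold rho; auto_derive; [exact I | field; exact Hx].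
  - unfold dtheta; simpl; fold rho; auto_derive; [exact I | field; exact Hx].
Qed.

Lemma energy_x1_eq (x y : R * R) :
  radius x <> 0 -> randers m mu x y = 1 ->
  energy_x1 m mu x y =
  (dr x y * (fst y - dr x y * fst x / radius x) / radius x
   + angular_momentum x y * (snd y - 2 * dtheta x y * fst x) / radius x ^ 2
   + (dtheta x y - mu) ^ 2 * (m (radius x) * Derive m (radius x) * fst x / radius x))
  / (1 + mu * angular_momentum x y).
Proof.
  destruct x as [x1 x2], y as [y1 y2]; intros Hx H1.
  set (x := (x1, x2)) in *; set (y := (y1, y2)) in *; set (rho := radius x) in *.
  set (a := dr x y); set (b := dtheta x y); set (nu := angular_momentum x y).
  unfold energy_x1; simpl snd; simpl fst.
  pose proof (is_derive_radius_1 x1 x2 Hx) as HR.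
  fold x in HR; fold rho in HR.
  set (f := fun u : R => radius (u, x2)); assert (HRx : f x1 = rho) by reflexivity.
  change (is_derive f x1 (x1 / rho)) in HR.
  rewrite (Derive_energy_line (fun u => (u, x2)) (fun _ => y) x1
    (x1 / rho) ((y1 - a * x1 / rho) / rho) ((y2 - 2 * b * x1) / rho ^ 2) Hx H1 HR).
  - cbv beta; fold x; fold rho; fold a; fold b; fold nu; unfold Rdiv; ring.
  - change (is_derive (fun z => (z * y1 + x2 * y2) / f z) x1 ((y1 - a * x1 / rho) / rho)).
    auto_derive; [split; [eexists; exact HR | split; [exact Hx | exact I]] |].
    replace (Derive _ x1) with (x1 / rho)
      by (symmetry; apply is_derive_unique, HR); rewrite HRx.
    unfold a, dr; fold rho; simpl; field; exact Hx.
  - change (is_derive (fun z => (z * y2 - x2 * y1) / f z ^ 2) x1 ((y2 - 2 * b * x1) / rho ^ 2)).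
    auto_derive; [split; [eexists; exact HR | split; [| exact I]] |].
    + apply Rmult_integral_contrapositive; rewrite Rmult_1_r; split; exact Hx.
    + replace (Derive _ x1) with (x1 / rho)
      by (symmetry; apply is_derive_unique, HR); rewrite HRx.
      unfold b, dtheta; fold rho; simpl; field; exact Hx.
Qed.

Lemma energy_x2_eq (x y : R * R) :
  radius x <> 0 -> randers m mu x y = 1 ->
  energy_x2 m mu x y =
  (dr x y * (snd y - dr x y * snd x / radius x) / radius x
   + angular_momentum x y * (- fst y - 2 * dtheta x y * snd x) / radius x ^ 2
   + (dtheta x y - mu) ^ 2 * (m (radius x) * Derive m (radius x) * snd x / radius x))
  / (1 + mu * angular_momentum x y).
Proof.
  destruct x as [x1 x2], y as [y1 y2]; intros Hx H1.
  set (x := (x1, x2)) in *; set (y := (y1, y2)) in *; set (rho := radius x) in *.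
  set (a := dr x y); set (b := dtheta x y); set (nu := angular_momentum x y).
  unfold energy_x2; simpl snd; simpl fst.
  pose proof (is_derive_radius_2 x1 x2 Hx) as HR.
  fold x in HR; fold rho in HR.
  set (f := fun u : R => radius (x1, u)); assert (HRx : f x2 = rho) by reflexivity.
  change (is_derive f x2 (x2 / rho)) in HR.
  rewrite (Derive_energy_line (fun u => (x1, u)) (fun _ => y) x2
    (x2 / rho) ((y2 - a * x2 / rho) / rho) ((- y1 - 2 * b * x2) / rho ^ 2) Hx H1 HR).
  - cbv beta; fold x; fold rho; fold a; fold b; fold nu; unfold Rdiv; ring.
  - change (is_derive (fun z => (x1 * y1 + z * y2) / f z) x2 ((y2 - a * x2 / rho) / rho)).
    auto_derive; [split; [eexists; exact HR | split; [exact Hx | exact I]] |].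
    replace (Derive _ x2) with (x2 / rho)
      by (symmetry; apply is_derive_unique, HR); rewrite HRx.
    unfold a, dr; fold rho; simpl; field; exact Hx.
  - change (is_derive (fun z => (x1 * y2 - z * y1) / f z ^ 2) x2 ((- y1 - 2 * b * x2) / rho ^ 2)).
    auto_derive; [split; [eexists; exact HR | split; [| exact I]] |].
    + apply Rmult_integral_contrapositive; rewrite Rmult_1_r; split; exact Hx.
    + replace (Derive _ x2) with (x2 / rho)
      by (symmetry; apply is_derive_unique, HR); rewrite HRx.
      unfold b, dtheta; fold rho; simpl; field; exact Hx.
Qed.

(** * Rays *)

(** The spiral has constant radial velocity [w] and constant angular velocity [om], run
    through in time [L].  Its F-speed is at most 1 because [w^2 + m^2 (om - mu)^2 <= 1],
    which follows from [m < 1 / mu] and [|om - mu| <= PI / L] by the choice of [L]. *)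
Lemma dist_F_le_spiral (x z : R * R) :
  0 < radius x ->
  Rbar_le (dist_F m mu x z)
    (Finite (sqrt ((radius z - radius x) ^ 2 + (PI / mu) ^ 2))).
Proof.
  intros Hx; pose proof (radius_nonneg z) as Hz.
  destruct (polar_angle x) as [th0 Ex]; destruct (polar_angle z) as [th1 Ez].
  set (r0 := radius x) in *; set (r1 := radius z) in *.
  assert (HPI : 0 < PI / mu) by (apply Rdiv_lt_0_compat; [apply PI_RGT_0 | exact Hmu]).
  assert (Hrad : 0 < (r1 - r0) ^ 2 + (PI / mu) ^ 2)
    by (pose proof (pow2_ge_0 (r1 - r0)); pose proof (pow_lt _ 2 HPI); lra).
  pose proof (sqrt_lt_R0 _ Hrad) as HL; pose proof (pow2_sqrt _ (Rlt_le _ _ Hrad)) as HL2.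
  set (L := sqrt _) in *.
  destruct (unit_vector_angle _ _ (cos_sin_sqr (th1 - th0 - mu * L)))
    as [d [Hd [Hcd Hsd]]].
  (* The wind contributes the angle [mu * L]; the curve itself turns by the
     remaining angle [d], chosen in [-PI, PI] modulo [2 * PI]. *)
  set (w := (r1 - r0) / L); set (om := mu + d / L).
  set (r := fun t => r0 + w * t); set (psi := fun t => th0 + om * t).
  set (c1 := fun t => r t * cos (psi t)); set (c2 := fun t => r t * sin (psi t)).
  set (v1 := fun t => w * cos (psi t) - r t * om * sin (psi t)).
  set (v2 := fun t => w * sin (psi t) + r t * om * cos (psi t)).
  assert (HrL : r L = r1) by (unfold r, w; field; lra).
  assert (HpsiL : psi L = d + (th0 + mu * L)) by (unfold psi, om; field; lra).
  assert (Hr : forall t, 0 < t < L -> 0 < r t).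
  { intros t Ht. replace (r t) with (r0 * (1 - t / L) + r1 * (t / L))
      by (unfold r, w; field; lra).
    assert (0 < t / L < 1).
    { split; [apply Rdiv_lt_0_compat; lra | apply Rlt_div_l; lra]. }
    assert (0 < r0 * (1 - t / L)) by (apply Rmult_lt_0_compat; lra).
    assert (0 <= r1 * (t / L)) by (apply Rmult_le_pos; lra). lra. }
  assert (HC : C1_curve (fun t => 0 <= t <= L) (fun t => (c1 t, c2 t)) (fun t => (v1 t, v2 t))).
  { apply C1_curve_of_derive; intros t _.
    - unfold c1, v1, r, psi; auto_derive; [exact I | ring].
    - unfold c2, v2, r, psi; auto_derive; [exact I | ring].
    - apply (ex_derive_continuous v1); unfold v1, r, psi; auto_derive; exact I.
    - apply (ex_derive_continuous v2); unfold v2, r, psi; auto_derive; exact I. }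
  pose proof (path_length_C1 m mu 0 L _ _ HL HC) as Hp.
  cbv beta in Hp; replace (c1 0, c2 0) with x in Hp.
  2: { rewrite Ex; unfold c1, c2, r, psi; rewrite !Rmult_0_r, !Rplus_0_r; reflexivity. }
  replace (c1 L, c2 L) with z in Hp.
  2: { rewrite Ez; unfold c1, c2; rewrite HrL, HpsiL.
       replace th1 with ((th1 - th0 - mu * L) + (th0 + mu * L)) at 1 2 by ring.
       rewrite !(cos_plus _ (th0 + mu * L)), !(sin_plus _ (th0 + mu * L)), Hcd, Hsd.
       reflexivity. }
  apply (proj1 (Glb_Rbar_correct (path_length m mu x z))) in Hp.
  apply Rbar_le_trans with (1 := Hp); simpl.
  (* At [t = L] the curve may reach the vertex, where [randers_polar] fails;
     the integrand is therefore rewritten on the open interval only. *)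
  set (f := fun t => polar_speed mu (m (r t) ^ 2) w om).
  rewrite (RInt_ext _ f).
  2: { intros t Ht; rewrite Rmin_left, Rmax_right in Ht by lra.
       pose proof (Hr t Ht) as Hrt.
       pose proof (radius_scaled_circle (r t) _ _ (Rlt_le _ _ Hrt) (cos_sin_sqr (psi t))) as HR.
       unfold c1, c2, v1, v2; rewrite randers_polar by (rewrite HR; lra).
       rewrite HR, dr_polar, dtheta_polar by (exact Hrt || apply cos_sin_sqr); reflexivity. }
  replace L with (RInt (fun _ => 1) 0 L) at 2
    by (rewrite RInt_const; unfold scal; simpl; unfold mult; simpl; ring).
  assert (Hmr : forall t, 0 <= t <= L -> mu ^ 2 * m (r t) ^ 2 < 1
     /\ continuous (fun s => m (r s) ^ 2) t).
  { intros t Ht.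
    assert (Hrt : 0 <= r t).
    { destruct (Req_dec t 0) as [-> | H0]; [unfold r; lra |].
      destruct (Req_dec t L) as [-> | H1]; [lra | left; apply Hr; lra]. }
    split; [apply wind_subunit, Hrt |].
    assert (Hc : continuous (fun s => m (r s)) t).
    { apply (continuous_comp r m).
      - apply (ex_derive_continuous r); unfold r; auto_derive; exact I.
      - apply (ex_derive_continuous m); eexists; apply is_derive_warping. }
    apply (continuous_mult (fun s => m (r s)) (fun s => m (r s) * 1)); [exact Hc |].
    apply (continuous_mult (fun s => m (r s)) (fun _ => 1)); [exact Hc |].
    apply continuous_const. }
  apply RInt_le; [lra | | apply ex_RInt_const |].
  - apply (ex_RInt_continuous f); intros t Ht; rewrite Rmin_left, Rmax_right in Ht by lra.
    apply (continuous_polar_speed mu (fun t => m (r t) ^ 2) (fun _ => om));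
      [apply Hmr, Ht | apply continuous_const | apply Hmr, Ht].
  - intros t Ht; apply polar_speed_le1; [apply pow2_ge_0 | apply Hmr; lra |].
    pose proof (Hr t Ht) as Hrt.
    pose proof (Hbound (r t) (Rlt_le _ _ Hrt)) as Hb.
    pose proof (warping_pos m Hm _ Hrt) as Hb0.
    replace (om - mu) with (d / L) by (unfold om; ring).
    assert (Hmd : m (r t) ^ 2 * d ^ 2 <= (PI / mu) ^ 2).
    { replace ((PI / mu) ^ 2) with ((1 / mu) ^ 2 * PI ^ 2) by (field; lra).
      apply Rmult_le_compat; try apply pow2_ge_0; apply pow_maj_Rabs.
      - rewrite Rabs_pos_eq; lra.
      - apply Rabs_le; exact Hd. }
    replace (w ^ 2 + m (r t) ^ 2 * (d / L) ^ 2)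
      with (((r1 - r0) ^ 2 + m (r t) ^ 2 * d ^ 2) / L ^ 2) by (unfold w; field; lra).
    apply Rle_div_l; [apply pow_lt, HL | lra].
Qed.

(** [dr y <= 1] for a unit vector, multiplied by the radius so as to hold at the
    vertex. *)
Lemma unit_vector_radial (x y : R * R) :
  randers m mu x y = 1 -> fst x * fst y + snd x * snd y <= radius x.
Proof.
  intros H1; destruct (Req_dec (radius x) 0) as [H0 | H0].
  - rewrite H0, (radius_eq0 x H0); unfold vertex; simpl; lra.
  - apply (unit_vector_polar _ _ H0) in H1.
    assert (Ha : dr x y <= 1).
    { assert (0 <= m (radius x) ^ 2 * (dtheta x y - mu) ^ 2)
        by (apply Rmult_le_pos; apply pow2_ge_0). nra. }
    pose proof (radius_nonneg x).
    replace (fst x * fst y + snd x * snd y) with (radius x * dr x y)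
      by (unfold dr; field; exact H0). nra.
Qed.

Lemma unit_speed_radius_increment (g v : R -> R * R) :
  C1_curve half_line g v -> (forall t, 0 <= t -> randers m mu (g t) (v t) = 1) ->
  forall s t, 0 <= s <= t -> radius (g t) - radius (g s) <= t - s.
Proof.
  intros Hg H1 s t Hst.
  (* [radius] is not differentiable at the vertex; sqrt (e^2 + radius^2) is. *)
  assert (Hreg : forall e, 0 < e ->
    sqrt (e ^ 2 + radius (g t) ^ 2) - sqrt (e ^ 2 + radius (g s) ^ 2) <= t - s).
  { intros e He; rewrite !radius_sqr.
    set (q := fun u => e ^ 2 + (fst (g u) ^ 2 + snd (g u) ^ 2)).
    assert (Hq : forall u, 0 < q u).
    { intros u; unfold q; pose proof (pow_lt e 2 He).
      pose proof (pow2_ge_0 (fst (g u))); pose proof (pow2_ge_0 (snd (g u))); lra. }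
    rewrite <- (Rmult_1_l (t - s)).
    apply (half_line_increment (fun u => sqrt (q u)) (fun u =>
      (fst (g u) * fst (v u) + snd (g u) * snd (v u)) / sqrt (q u)) 1 s t); [| | | exact Hst].
    - intros u; destruct (C1_continuous g v Hg u) as [C1 [C2 _]].
      apply continuous_sqrt_comp.
      apply (continuous_plus (fun _ => e ^ 2)); [apply continuous_const |].
      apply (continuous_plus (fun z => fst (g (Rmax 0 z)) ^ 2)
                             (fun z => snd (g (Rmax 0 z)) ^ 2)).
      + apply (continuous_comp (fun z => fst (g (Rmax 0 z))) (fun w => w ^ 2)); [exact C1 |].
        apply (ex_derive_continuous (fun w : R => w ^ 2)); auto_derive; exact I.
      + apply (continuous_comp (fun z => snd (g (Rmax 0 z))) (fun w => w ^ 2)); [exact C2 |].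
        apply (ex_derive_continuous (fun w : R => w ^ 2)); auto_derive; exact I.
    - intros u Hu; pose proof (C1_derive_1 g v Hg u Hu) as D1.
      pose proof (C1_derive_2 g v Hg u Hu) as D2.
      pose proof (Hq u) as Hqu; pose proof (sqrt_lt_R0 _ Hqu).
      set (x1 := fun s => fst (g s)) in *; set (x2 := fun s => snd (g s)) in *.
      change (is_derive (fun u => sqrt (e ^ 2 + (x1 u ^ 2 + x2 u ^ 2))) u
        ((x1 u * fst (v u) + x2 u * snd (v u)) / sqrt (e ^ 2 + (x1 u ^ 2 + x2 u ^ 2)))).
      change (0 < e ^ 2 + (x1 u ^ 2 + x2 u ^ 2)) in Hqu.
      auto_derive.
      + repeat split; try (eexists; eassumption); simpl in Hqu; lra.
      + replace (Derive _ u) with (fst (v u)) by (symmetry; apply is_derive_unique, D1).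
        replace (Derive _ u) with (snd (v u)) by (symmetry; apply is_derive_unique, D2).
        simpl in *; field; apply Rgt_not_eq; assumption.
    - intros u Hu; apply Rle_div_l; [apply sqrt_lt_R0, Hq |].
      rewrite Rmult_1_l; apply Rle_trans with (1 := unit_vector_radial _ _ (H1 u Hu)).
      unfold radius; apply sqrt_le_1_alt; unfold q; pose proof (pow2_ge_0 e); lra. }
  apply le_epsilon; intros e He.
  specialize (Hreg e He).
  pose proof (radius_nonneg (g s)) as Hs; pose proof (radius_nonneg (g t)) as Ht.
  assert (Ht' : radius (g t) <= sqrt (e ^ 2 + radius (g t) ^ 2)).
  { rewrite <- (sqrt_pow2 _ Ht) at 1; apply sqrt_le_1_alt; pose proof (pow2_ge_0 e); lra. }
  assert (Hs' : sqrt (e ^ 2 + radius (g s) ^ 2) <= radius (g s) + e).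
  { rewrite <- (sqrt_pow2 (radius (g s) + e)) by lra; apply sqrt_le_1_alt; nra. }
  lra.
Qed.

(** The radius cannot grow faster than the time, and a ray cannot afford any loss:
    the spirals of [dist_F_le_spiral] would eventually be shorter. *)
Lemma ray_radius (g v : R -> R * R) :
  0 < radius (g 0) -> C1_curve half_line g v ->
  (forall t, 0 <= t -> randers m mu (g t) (v t) = 1) ->
  (forall s, 0 <= s -> dist_F m mu (g 0) (g s) = Finite s) ->
  forall s, 0 <= s -> radius (g s) = radius (g 0) + s.
Proof.
  intros H0 Hg H1 Hray s Hs.
  pose proof (unit_speed_radius_increment g v Hg H1) as Hinc.
  apply Rle_antisym; [pose proof (Hinc 0 s ltac:(lra)); lra |].
  apply Rnot_lt_le; intros Hlt.
  set (d := radius (g 0) + s - radius (g s)) in *.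
  assert (Hd : 0 < d) by (unfold d; lra).
  (* The defect [d] persists for ever; at the time [u] below, the bound of
     [dist_F_le_spiral] has dropped below [u]. *)
  set (C := (PI / mu) ^ 2).
  assert (HC : 0 <= C) by apply pow2_ge_0.
  set (u := s + radius (g 0) + d + (d ^ 2 + C) / d).
  assert (HCd : 0 <= (d ^ 2 + C) / d)
    by (apply Rdiv_le_0_compat; [pose proof (pow2_ge_0 d); lra | exact Hd]).
  assert (Hu : s <= u) by (unfold u; lra).
  pose proof (Hinc s u ltac:(lra)) as Hsu.
  pose proof (radius_nonneg (g u)) as Hru.
  pose proof (dist_F_le_spiral (g 0) (g u) H0) as Hdist.
  rewrite Hray in Hdist by lra; simpl in Hdist.
  assert (Hsq : u ^ 2 <= (radius (g u) - radius (g 0)) ^ 2 + C).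
  { rewrite <- (pow2_sqrt (_ + C)).
    - apply pow_incr; split; [lra | exact Hdist].
    - pose proof (pow2_ge_0 (radius (g u) - radius (g 0))); lra. }
  assert (Hdev : (radius (g u) - radius (g 0)) ^ 2 <= (u - d) ^ 2).
  { apply pow_maj_Rabs, Rabs_le; unfold d in *; unfold u in *; lra. }
  assert (Hud : d ^ 2 + C < u * d).
  { apply Rlt_div_l; [exact Hd | unfold u; lra]. }
  nra.
Qed.

(** Growing at rate 1, the radius uses up the whole h-length of the velocity freed from
    the wind, which leaves no room for a component along the parallel. *)
Lemma ray_initially_tangent (g : R -> R * R) :
  g 0 <> vertex -> forward_ray m mu g -> tangent_to_twisted_meridian mu g.
Proof.
  intros Hq [[v [Hg [H1 _]]] Hray].
  pose proof (radius_pos _ Hq) as H0.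
  pose proof (ray_radius g v H0 Hg H1 Hray) as Hr.
  set (r0 := radius (g 0)) in *.
  destruct (polar_angle (g 0)) as [th Eth]; fold r0 in Eth.
  (* [radius (g t) = r0 + t] forces [dr = 1], and unit speed then forces
     [dtheta = mu]. *)
  assert (Hv : forall t, 0 < t ->
    fst (v t) = fst (g t) / (r0 + t) - mu * snd (g t) /\
    snd (v t) = snd (g t) / (r0 + t) + mu * fst (g t)).
  { intros t Ht; pose proof (Hr t ltac:(lra)) as Hrt.
    assert (Hn : radius (g t) <> 0) by lra.
    assert (Hdot : fst (g t) * fst (v t) + snd (g t) * snd (v t) = r0 + t).
    { pose proof (C1_derive_1 g v Hg t Ht) as D1; pose proof (C1_derive_2 g v Hg t Ht) as D2.
      set (x1 := fun s => fst (g s)) in *; set (x2 := fun s => snd (g s)) in *.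
      assert (Dl : is_derive (fun s => x1 s ^ 2 + x2 s ^ 2) t
                     (2 * (x1 t * fst (v t) + x2 t * snd (v t)))).
      { auto_derive; [repeat split; eexists; eassumption |].
        replace (Derive _ t) with (fst (v t)) by (symmetry; apply is_derive_unique, D1).
        replace (Derive _ t) with (snd (v t)) by (symmetry; apply is_derive_unique, D2).
        ring. }
      assert (Dr : is_derive (fun s => x1 s ^ 2 + x2 s ^ 2) t (2 * (r0 + t))).
      { apply (is_derive_ext_loc (fun s => (r0 + s) ^ 2)).
        - generalize (open_gt 0 t Ht); apply filter_imp; intros y Hy.
          rewrite <- Hr by lra; apply radius_sqr.
        - auto_derive; [exact I | ring]. }
      apply is_derive_unique in Dl; apply is_derive_unique in Dr.
      change (x1 t * fst (v t) + x2 t * snd (v t) = r0 + t); lra. }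
    pose proof (proj1 (unit_vector_polar _ _ Hn) (H1 t ltac:(lra))) as HF.
    assert (Ha : dr (g t) (v t) = 1) by (unfold dr; rewrite Hdot, Hrt; field; lra).
    pose proof (warping_pos m Hm (radius (g t)) ltac:(lra)) as Hmp.
    assert (Hb : dtheta (g t) (v t) = mu).
    { rewrite Ha in HF.
      assert (Hz : (m (radius (g t)) * (dtheta (g t) (v t) - mu)) ^ 2 = 0)
        by (rewrite Rpow_mult_distr; lra).
      rewrite <- Rsqr_pow2 in Hz; apply Rsqr_0_uniq in Hz.
      apply Rmult_integral in Hz; lra. }
    assert (Hcross : fst (g t) * snd (v t) - snd (g t) * fst (v t) = mu * (r0 + t) ^ 2).
    { rewrite <- Hb; unfold dtheta; rewrite Hrt; field; lra. }
    pose proof (radius_sqr (g t)) as Hs; rewrite Hrt in Hs.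
    apply velocity_from_dot_cross; try assumption; [lra | symmetry; exact Hs]. }
  (* The velocity at the end point 0 is the limit of those at positive times. *)
  assert (Hv0 : v 0 = (cos th - mu * (r0 * sin th), sin th + mu * (r0 * cos th))).
  { assert (Hr0 : forall z, r0 + Rmax 0 z <> 0) by (intros z; pose proof (Rmax_l 0 z); lra).
    assert (Hi : forall z, continuous (fun u => / (r0 + Rmax 0 u)) z).
    { intros z; apply continuous_Rinv_comp; [| apply Hr0].
      apply (continuous_plus (fun _ => r0)); [apply continuous_const |].
      apply (continuous_on_half_line_extend (fun u : R => u)); intros u _ P HP.
      apply filter_le_within, HP. }
    assert (E1 : fst (v 0) - (fst (g 0) / (r0 + 0) - mu * snd (g 0)) = 0).
    { apply (half_line_value_at_0
        (fun t => fst (v t) - (fst (g t) / (r0 + t) - mu * snd (g t)))).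
      - intros z; destruct (C1_continuous g v Hg z) as [C1 [C2 [C3 C4]]].
        apply (continuous_minus (fun u => fst (v (Rmax 0 u)))); [exact C3 |].
        apply (continuous_minus (fun u => fst (g (Rmax 0 u)) / (r0 + Rmax 0 u))).
        + apply (continuous_mult (fun u => fst (g (Rmax 0 u)))); [exact C1 | apply Hi].
        + apply (continuous_scal_r mu (fun u => snd (g (Rmax 0 u)))), C2.
      - intros t Ht; rewrite (proj1 (Hv t Ht)); ring. }
    assert (E2 : snd (v 0) - (snd (g 0) / (r0 + 0) + mu * fst (g 0)) = 0).
    { apply (half_line_value_at_0
        (fun t => snd (v t) - (snd (g t) / (r0 + t) + mu * fst (g t)))).
      - intros z; destruct (C1_continuous g v Hg z) as [C1 [C2 [C3 C4]]].
        apply (continuous_minus (fun u => snd (v (Rmax 0 u)))); [exact C4 |].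
        apply (continuous_plus (fun u => snd (g (Rmax 0 u)) / (r0 + Rmax 0 u))).
        + apply (continuous_mult (fun u => snd (g (Rmax 0 u)))); [exact C2 | apply Hi].
        + apply (continuous_scal_r mu (fun u => fst (g (Rmax 0 u)))), C1.
      - intros t Ht; rewrite (proj2 (Hv t Ht)); ring. }
    rewrite Eth, Rplus_0_r in E1, E2; simpl fst in E1, E2; simpl snd in E1, E2.
    replace (r0 * cos th / r0) with (cos th) in E1 by (field; lra).
    replace (r0 * sin th / r0) with (sin th) in E2 by (field; lra).
    destruct (v 0) as [a b]; simpl in E1, E2; f_equal; lra. }
  exists (th - mu * r0), r0, 1, (v 0), (v 0).
  unfold twisted_meridian. replace (th - mu * r0 + mu * r0) with th by ring.
  split; [lra |]. split; [symmetry; exact Eth |].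
  split; [apply (proj1 Hg), Rle_refl |].
  split; [| symmetry; apply (scal_one (v 0))].
  rewrite Hv0; apply is_derive_pair; auto_derive; try exact I;
    replace (th - mu * r0 + mu * r0) with th by ring; ring.
Qed.

(** * Geodesics from the vertex *)

(** At the vertex the wind vanishes and F is the Euclidean norm. *)
Lemma energy_y_vertex (x y : R * R) :
  radius x = 0 -> energy_y1 m mu x y = fst y /\ energy_y2 m mu x y = snd y.
Proof.
  intros Hx; rewrite (radius_eq0 x Hx).
  assert (E : forall z, energy m mu vertex z = (fst z ^ 2 + snd z ^ 2) / 2).
  { intros z; unfold energy; rewrite randers_vertex by apply (warping_0 m Hm).
    rewrite pow2_sqrt; [reflexivity |].
    pose proof (pow2_ge_0 (fst z)); pose proof (pow2_ge_0 (snd z)); lra. }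
  unfold energy_y1, energy_y2; split; apply is_derive_unique.
  - apply (is_derive_ext (fun u => (u ^ 2 + snd y ^ 2) / 2)).
    + intros u; symmetry; apply (E (u, snd y)).
    + auto_derive; [exact I | field].
  - apply (is_derive_ext (fun u => (fst y ^ 2 + u ^ 2) / 2)).
    + intros u; symmetry; apply (E (fst y, u)).
    + auto_derive; [exact I | field].
Qed.

(** The derivative of the energy along the infinitesimal rotation of both arguments
    is zero.  It is the derivative of the moment of the momentum along a solution of the
    Euler-Lagrange equations. *)
Lemma energy_rotation_invariance (x y : R * R) :
  randers m mu x y = 1 ->
  - fst x * energy_x2 m mu x y + snd x * energy_x1 m mu x y
  = fst y * energy_y2 m mu x y - snd y * energy_y1 m mu x y.
Proof.
  intros H1; destruct (Req_dec (radius x) 0) as [Hx | Hx].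
  - destruct (energy_y_vertex x y Hx) as [-> ->].
    rewrite (radius_eq0 x Hx); unfold vertex; simpl; ring.
  - pose proof (radius_nonneg x) as Hr0.
    pose proof (momentum_scale_pos x y Hx H1) as HS.
    rewrite energy_x1_eq, energy_x2_eq, energy_y1_eq, energy_y2_eq by assumption.
    pose proof (radius_sqr x) as Hs.
    set (nu := angular_momentum x y) in *; set (rho := radius x) in *.
    assert (Hb : dtheta x y = (fst x * snd y - snd x * fst y) / rho ^ 2) by reflexivity.
    set (a := dr x y) in *; set (b := dtheta x y) in *.
    field; lra.
Qed.

(** The moment [x1 E_y2 - x2 E_y1] is constant and zero at the start, and it equals
    [nu / (1 + mu nu)] off the vertex. *)
Lemma vertex_geodesic_momentum (g v : R -> R * R) :
  g 0 = vertex -> C1_curve half_line g v ->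
  (forall t, 0 <= t -> randers m mu (g t) (v t) = 1) ->
  (forall t, 0 <= t ->
     filterdiff (fun s => energy_y1 m mu (g s) (v s)) (within half_line (locally t))
       (fun s => scal s (energy_x1 m mu (g t) (v t)))) ->
  (forall t, 0 <= t ->
     filterdiff (fun s => energy_y2 m mu (g s) (v s)) (within half_line (locally t))
       (fun s => scal s (energy_x2 m mu (g t) (v t)))) ->
  forall t, 0 <= t -> radius (g t) <> 0 -> dtheta (g t) (v t) = mu.
Proof.
  intros H0 Hg H1 HE1 HE2.
  set (e1 := fun s => energy_y1 m mu (g s) (v s)) in *.
  set (e2 := fun s => energy_y2 m mu (g s) (v s)) in *.
  set (x1 := fun s => fst (g s)); set (x2 := fun s => snd (g s)).
  assert (HK : forall t, 0 <= t ->
    x1 t * e2 t - x2 t * e1 t = x1 0 * e2 0 - x2 0 * e1 0 + 0 * t).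
  { apply (half_line_affine (fun t => x1 t * e2 t - x2 t * e1 t)).
    - intros u; destruct (C1_continuous g v Hg u) as [C1 [C2 _]].
      pose proof (continuous_on_half_line_extend e1
        (filterdiff_continuous_on_half_line e1 _ HE1) u) as Ce1.
      pose proof (continuous_on_half_line_extend e2
        (filterdiff_continuous_on_half_line e2 _ HE2) u) as Ce2.
      apply (continuous_minus (fun z => x1 (Rmax 0 z) * e2 (Rmax 0 z))
                              (fun z => x2 (Rmax 0 z) * e1 (Rmax 0 z))).
      + apply (continuous_mult (fun z => x1 (Rmax 0 z))); assumption.
      + apply (continuous_mult (fun z => x2 (Rmax 0 z))); assumption.
    - intros u Hu.
      pose proof (C1_derive_1 g v Hg u Hu) as D1; pose proof (C1_derive_2 g v Hg u Hu) as D2.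
      assert (De1 : is_derive e1 u (energy_x1 m mu (g u) (v u)))
        by apply (filterdiff_half_line_interior e1 _ u Hu), HE1, Rlt_le, Hu.
      assert (De2 : is_derive e2 u (energy_x2 m mu (g u) (v u)))
        by apply (filterdiff_half_line_interior e2 _ u Hu), HE2, Rlt_le, Hu.
      fold x1 in D1; fold x2 in D2.
      pose proof (energy_rotation_invariance _ _ (H1 u (Rlt_le _ _ Hu))) as Hinv.
      auto_derive; [repeat split; eexists; eassumption |].
      replace (Derive _ u) with (fst (v u)) by (symmetry; apply is_derive_unique, D1).
      replace (Derive _ u) with (energy_x2 m mu (g u) (v u))
        by (symmetry; apply is_derive_unique, De2).
      replace (Derive _ u) with (snd (v u)) by (symmetry; apply is_derive_unique, D2).
      replace (Derive _ u) with (energy_x1 m mu (g u) (v u))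
        by (symmetry; apply is_derive_unique, De1).
      unfold x1, x2, e1, e2; lra. }
  intros t Ht Hx; specialize (HK t Ht).
  unfold x1, x2 in HK; rewrite H0 in HK; unfold vertex, e1, e2 in HK; simpl in HK.
  pose proof (radius_nonneg (g t)) as Hr0.
  pose proof (momentum_scale_pos _ _ Hx (H1 t Ht)) as HS.
  rewrite energy_y1_eq, energy_y2_eq in HK by auto.
  pose proof (radius_sqr (g t)) as Hs.
  pose proof (warping_pos m Hm (radius (g t)) ltac:(lra)) as Hmp.
  assert (Hnu : angular_momentum (g t) (v t) = 0).
  { apply (Rmult_eq_reg_r (/ (1 + mu * angular_momentum (g t) (v t))));
      [| apply Rinv_neq_0_compat; lra].
    match type of HK with ?l = ?r => transitivity l; [| rewrite HK; ring] end.
    set (nu := angular_momentum (g t) (v t)) in *.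
    set (rho := radius (g t)) in *.
    transitivity (nu * (fst (g t) ^ 2 + snd (g t) ^ 2) / rho ^ 2 / (1 + mu * nu)).
    - rewrite <- Hs; field; lra.
    - field; lra. }
  unfold angular_momentum in Hnu; apply Rmult_integral in Hnu.
  destruct Hnu as [Hz | Hz]; [| lra].
  pose proof (pow_lt _ 2 Hmp); lra.
Qed.

(** The function [la = <g, v>] is the signed distance to the vertex: [la^2 = |g|^2],
    as [v] is radial up to the wind, and [(|g|^2)' = 2 la].  So [la' = 1], including at
    times when [g] might return to the vertex, where [la] is differentiated as the
    product of a vanishing factor with a continuous one. *)
Lemma vertex_geodesic_radial (g v : R -> R * R) :
  g 0 = vertex -> C1_curve half_line g v ->
  (forall t, 0 <= t -> randers m mu (g t) (v t) = 1) ->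
  (forall t, 0 <= t -> radius (g t) <> 0 -> dtheta (g t) (v t) = mu) ->
  forall t, 0 <= t -> fst (g t) * fst (v t) + snd (g t) * snd (v t) = t
                      /\ radius (g t) = t.
Proof.
  intros H0 Hg H1 Hmom.
  set (x1 := fun s => fst (g s)); set (x2 := fun s => snd (g s)).
  set (v1 := fun s => fst (v s)); set (v2 := fun s => snd (v s)).
  set (la := fun s => x1 s * v1 s + x2 s * v2 s).
  assert (Hsq : forall t, 0 <= t -> la t ^ 2 = radius (g t) ^ 2).
  { intros t Ht; destruct (Req_dec (radius (g t)) 0) as [Hx | Hx].
    - unfold la, x1, x2; rewrite Hx, (radius_eq0 _ Hx); unfold vertex; simpl; ring.
    - pose proof (proj1 (unit_vector_polar _ _ Hx) (H1 t Ht)) as HF.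
      rewrite (Hmom t Ht Hx) in HF.
      assert (Ha : dr (g t) (v t) ^ 2 = 1)
        by (rewrite <- HF; unfold Rminus; rewrite Rplus_opp_r; ring).
      replace (la t) with (radius (g t) * dr (g t) (v t))
        by (unfold la, x1, x2, v1, v2, dr; field; exact Hx).
      rewrite Rpow_mult_distr, Ha; ring. }
  assert (Hd1 : forall t, 0 < t -> is_derive x1 t (v1 t)) by apply (C1_derive_1 g v Hg).
  assert (Hd2 : forall t, 0 < t -> is_derive x2 t (v2 t)) by apply (C1_derive_2 g v Hg).
  assert (Hext : forall u, continuous (fun z => la (Rmax 0 z)) u).
  { intros u; destruct (C1_continuous g v Hg u) as [C1 [C2 [C3 C4]]].
    apply (continuous_plus (fun z => x1 (Rmax 0 z) * v1 (Rmax 0 z))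
                           (fun z => x2 (Rmax 0 z) * v2 (Rmax 0 z))).
    - apply (continuous_mult (fun z => x1 (Rmax 0 z))); assumption.
    - apply (continuous_mult (fun z => x2 (Rmax 0 z))); assumption. }
  assert (Hint : forall (f : R -> R) t, 0 < t ->
    continuous (fun z => f (Rmax 0 z)) t -> continuous f t).
  { intros f t Ht Hc; apply (continuous_ext_loc f (fun z => f (Rmax 0 z))); [| exact Hc].
    generalize (open_gt 0 t Ht); apply filter_imp; intros y Hy.
    rewrite Rmax_right; [reflexivity | lra]. }
  assert (Hder : forall t, 0 < t -> is_derive la t 1).
  { intros t Ht; destruct (C1_continuous g v Hg t) as [_ [_ [C3 C4]]].
    apply (Hint v1 t Ht) in C3; apply (Hint v2 t Ht) in C4.
    pose proof (Hd1 t Ht) as D1; pose proof (Hd2 t Ht) as D2.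
    destruct (Req_dec (la t) 0) as [Hz | Hz].
    - (* [g] passes through the vertex, with a Euclidean unit velocity. *)
      pose proof (Hsq t (Rlt_le _ _ Ht)) as Hx; rewrite Hz in Hx.
      assert (Hr : radius (g t) = 0) by nra.
      apply radius_eq0 in Hr.
      assert (E1 : x1 t = 0) by (unfold x1; rewrite Hr; reflexivity).
      assert (E2 : x2 t = 0) by (unfold x2; rewrite Hr; reflexivity).
      assert (Hv : v1 t ^ 2 + v2 t ^ 2 = 1).
      { pose proof (H1 t (Rlt_le _ _ Ht)) as HF.
        rewrite Hr, randers_vertex in HF by apply (warping_0 m Hm).
        change (sqrt (v1 t ^ 2 + v2 t ^ 2) = 1) in HF.
        rewrite <- (pow2_sqrt (v1 t ^ 2 + v2 t ^ 2)); [rewrite HF; ring |].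
        pose proof (pow2_ge_0 (v1 t)); pose proof (pow2_ge_0 (v2 t)); lra. }
      destruct (slope_continuous x1 t _ D1) as [q1 [Cq1 [Eq1 Hq1]]].
      destruct (slope_continuous x2 t _ D2) as [q2 [Cq2 [Eq2 Hq2]]].
      replace 1 with (q1 t * v1 t + q2 t * v2 t) by (rewrite Eq1, Eq2, <- Hv; ring).
      apply (is_derive_of_slope la (fun s => q1 s * v1 s + q2 s * v2 s)).
      + apply (continuous_plus (fun s => q1 s * v1 s) (fun s => q2 s * v2 s)).
        * apply (continuous_mult q1 v1); assumption.
        * apply (continuous_mult q2 v2); assumption.
      + apply filter_forall; intros s; rewrite Hz; unfold la.
        rewrite (Hq1 s), (Hq2 s), E1, E2; ring.
    - apply is_derive_signed_root; [apply Hint; [exact Ht | apply Hext] | exact Hz |].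
      apply (is_derive_ext_loc (fun s => x1 s ^ 2 + x2 s ^ 2)).
      + generalize (open_gt 0 t Ht); apply filter_imp; intros y Hy.
        rewrite Hsq by lra; symmetry; apply radius_sqr.
      + auto_derive; [repeat split; eexists; eassumption |].
        replace (Derive _ t) with (v1 t) by (symmetry; apply is_derive_unique, D1).
        replace (Derive _ t) with (v2 t) by (symmetry; apply is_derive_unique, D2).
        unfold la; ring. }
  intros t Ht; assert (Hla : la t = t).
  { rewrite (half_line_affine la 1 Hext Hder t Ht).
    unfold la, x1, x2; rewrite H0; unfold vertex; simpl; ring. }
  split; [exact Hla |].
  specialize (Hsq t Ht); rewrite Hla in Hsq.
  pose proof (radius_nonneg (g t)); nra.
Qed.

Lemma vertex_geodesic_twisted_meridian (g : R -> R * R) :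
  g 0 = vertex -> unit_speed_geodesic m mu g ->
  exists th, forall t, 0 <= t -> g t = twisted_meridian mu th t.
Proof.
  intros H0 [v [Hg [H1 [HE1 HE2]]]].
  pose proof (vertex_geodesic_momentum g v H0 Hg H1 HE1 HE2) as Hmom.
  pose proof (vertex_geodesic_radial g v H0 Hg H1 Hmom) as Hrad.
  set (x1 := fun s => fst (g s)); set (x2 := fun s => snd (g s)).
  assert (Hv : forall t, 0 < t ->
    fst (v t) = x1 t / t - mu * x2 t /\ snd (v t) = x2 t / t + mu * x1 t).
  { intros t Ht; destruct (Hrad t (Rlt_le _ _ Ht)) as [Hdot Hr].
    pose proof (Hmom t (Rlt_le _ _ Ht) ltac:(lra)) as Hb.
    pose proof (radius_sqr (g t)) as Hs; rewrite Hr in Hs.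
    assert (Hcross : fst (g t) * snd (v t) - snd (g t) * fst (v t) = mu * t ^ 2).
    { rewrite <- Hb; unfold dtheta; rewrite Hr; field; lra. }
    apply velocity_from_dot_cross; try assumption; [lra | symmetry; exact Hs]. }
  (* The direction of [g t], rotated back by the angle [mu * t], is constant. *)
  set (c1 := fun t => (x1 t * cos (mu * t) + x2 t * sin (mu * t)) / t).
  set (c2 := fun t => (x2 t * cos (mu * t) - x1 t * sin (mu * t)) / t).
  assert (Hc : forall t, 0 < t -> is_derive c1 t 0 /\ is_derive c2 t 0).
  { intros t Ht; destruct (Hv t Ht) as [V1 V2].
    pose proof (C1_derive_1 g v Hg t Ht) as D1; pose proof (C1_derive_2 g v Hg t Ht) as D2.
    fold x1 in D1; fold x2 in D2; rewrite V1 in D1; rewrite V2 in D2.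
    split.
    - unfold c1; auto_derive.
      + repeat split; try (eexists; eassumption); lra.
      + replace (Derive _ t) with (x1 t / t - mu * x2 t)
          by (symmetry; apply is_derive_unique, D1).
        replace (Derive _ t) with (x2 t / t + mu * x1 t)
          by (symmetry; apply is_derive_unique, D2).
        field; lra.
    - unfold c2; auto_derive.
      + repeat split; try (eexists; eassumption); lra.
      + replace (Derive _ t) with (x2 t / t + mu * x1 t)
          by (symmetry; apply is_derive_unique, D2).
        replace (Derive _ t) with (x1 t / t - mu * x2 t)
          by (symmetry; apply is_derive_unique, D1).
        field; lra. }
  assert (Hconst : forall f : R -> R, (forall t, 0 < t -> is_derive f t 0) ->
    forall t, 0 < t -> f t = f 1).
  { intros f Hf t Ht; destruct (Rtotal_order t 1) as [Hl | [-> | Hl]]; [| reflexivity |].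
    - apply (eq_is_derive f t 1); [intros u Hu; apply Hf; lra | exact Hl].
    - symmetry; apply (eq_is_derive f 1 t); [intros u Hu; apply Hf; lra | exact Hl]. }
  destruct (unit_vector_angle (c1 1) (c2 1)) as [th [_ [Ec1 Ec2]]].
  { destruct (Hrad 1 ltac:(lra)) as [_ Hr].
    pose proof (radius_sqr (g 1)) as Hs; rewrite Hr in Hs.
    transitivity ((x1 1 ^ 2 + x2 1 ^ 2) * (cos (mu * 1) ^ 2 + sin (mu * 1) ^ 2));
      [unfold c1, c2; field |].
    rewrite cos_sin_sqr; unfold x1, x2; rewrite <- Hs; ring. }
  exists th; intros t [Ht | <-].
  - pose proof (Hconst c1 (fun u Hu => proj1 (Hc u Hu)) t Ht) as E1.
    pose proof (Hconst c2 (fun u Hu => proj2 (Hc u Hu)) t Ht) as E2.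
    unfold twisted_meridian; rewrite cos_plus, sin_plus, Ec1, Ec2, <- E1, <- E2.
    assert (G1 : fst (g t) = t * (c1 t * cos (mu * t) - c2 t * sin (mu * t))).
    { transitivity (x1 t * (cos (mu * t) ^ 2 + sin (mu * t) ^ 2)).
      - rewrite cos_sin_sqr; unfold x1; ring.
      - unfold c1, c2; field; lra. }
    assert (G2 : snd (g t) = t * (c2 t * cos (mu * t) + c1 t * sin (mu * t))).
    { transitivity (x2 t * (cos (mu * t) ^ 2 + sin (mu * t) ^ 2)).
      - rewrite cos_sin_sqr; unfold x2; ring.
      - unfold c1, c2; field; lra. }
    rewrite (surjective_pairing (g t)), G1, G2; reflexivity.
  - rewrite H0; unfold vertex, twisted_meridian; rewrite !Rmult_0_l; reflexivity.
Qed.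

Lemma vertex_is_pole : pole m mu vertex.
Proof.
  intros g1 g2 G1 G2 H1 H2 [u [Hu Hne]] s t Hs Ht E.
  destruct (vertex_geodesic_twisted_meridian g1 H1 G1) as [th1 E1].
  destruct (vertex_geodesic_twisted_meridian g2 H2 G2) as [th2 E2].
  assert (Hst : s = t).
  { rewrite <- (radius_scaled_circle s _ _ (Rlt_le _ _ Hs) (cos_sin_sqr (th1 + mu * s))).
    rewrite <- (radius_scaled_circle t _ _ Ht (cos_sin_sqr (th2 + mu * t))).
    f_equal; change (twisted_meridian mu th1 s = twisted_meridian mu th2 t).
    rewrite <- E1, <- E2 by lra; exact E. }
  subst t; apply Hne.
  rewrite E1, E2 in E by lra; rewrite E1, E2 by exact Hu.
  unfold twisted_meridian in *; injection E as Ec Es.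
  apply Rmult_eq_reg_l in Ec; [| lra]; apply Rmult_eq_reg_l in Es; [| lra].
  replace (th1 + mu * u) with ((th1 + mu * s) + mu * (u - s)) by ring.
  replace (th2 + mu * u) with ((th2 + mu * s) + mu * (u - s)) by ring.
  rewrite !(cos_plus _ (mu * (u - s))), !(sin_plus _ (mu * (u - s))), Ec, Es; reflexivity.
Qed.

(** * Geodesics starting along a parallel *)

Lemma Derive_warping_lipschitz (k B : R) :
  exists L, forall x y, Rabs x <= B -> Rabs y <= B ->
    Rabs (k * Derive m x - k * Derive m y) <= L * Rabs (x - y).
Proof.
  assert (Hd : forall x, is_derive (Derive m) x (Derive_n m 2 x)).
  { intros x; apply (Derive_correct (Derive_n m 1)), (warping_smooth m Hm 2). }
  destruct (continuity_ab_maj (fun x => Rabs (k * Derive_n m 2 x)) (- Rabs B) (Rabs B))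
    as [z [Hz _]].
  - pose proof (Rabs_pos B); lra.
  - intros x _; apply continuity_pt_filterlim.
    apply (continuous_comp (fun x => k * Derive_n m 2 x) Rabs), continuous_Rabs.
    apply (continuous_scal_r k (Derive_n m 2)).
    apply (ex_derive_continuous (Derive_n m 2)), (warping_smooth m Hm 3).
  - exists (Rabs (k * Derive_n m 2 z)).
    apply (lipschitz_of_derive (fun x => k * Derive m x) (fun x => k * Derive_n m 2 x)
             (fun x => Rabs x <= B)).
    + intros u v w Hu Hv Hw; apply Rabs_le_between in Hu; apply Rabs_le_between in Hv.
      apply Rabs_le_between; lra.
    + intros x _; apply (is_derive_scal (Derive m)), Hd.
    + intros x Hx; apply Hz; apply Rabs_le_between in Hx; pose proof (RRle_abs B); lra.
Qed.

(** With [p] the tangent of the angle between the geodesic and the parallel, the geodesic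
    equation becomes [r' = p / sqrt (1 + p^2)], [p' = m'(r) / nu], whose right-hand sides
    are smooth for all real [r] and [p].  The energy sqrt(1 + p^2) - m(r) / nu is Clairaut's
    relation; it also keeps [m(r) >= nu], hence [r > 0]. *)
Lemma radial_profile (r0 : R) :
  0 < r0 ->
  exists r w : R -> R, r 0 = r0 /\ forall t,
    0 < r t /\ is_derive r t (w t) /\
    is_derive w t (m r0 ^ 2 * Derive m (r t) / m (r t) ^ 3) /\
    w t ^ 2 + m r0 ^ 2 / m (r t) ^ 2 = 1.
Proof.
  intros Hr0; set (nu := m r0).
  assert (Hnu : 0 < nu) by apply (warping_pos m Hm r0 Hr0).
  destruct (bounded_speed_ode (fun x => / nu * Derive m x) slope_to_speed r0
    slope_to_speed_short slope_to_speed_bound (Derive_warping_lipschitz (/ nu)))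
    as [r [p [Er [Ep Hode]]]].
  (* Conservation of energy, with potential energy [- m / nu]; the initial value
     is 0 because [p 0 = 0] and [m (r 0) = nu]. *)
  assert (Hen : forall t, sqrt (1 + p t ^ 2) - / nu * m (r t) = 0).
  { set (en := fun t => sqrt (1 + p t ^ 2) - / nu * m (r t)).
    assert (Hd : forall t, is_derive en t 0).
    { intros t; destruct (Hode t) as [Dr Dp].
      pose proof (is_derive_comp (fun q => sqrt (1 + q ^ 2)) p t _ _
        (is_derive_sqrt_1_plus_sqr (p t)) Dp) as D1.
      pose proof (is_derive_scal _ t (/ nu) _
        (is_derive_comp m r t _ _ (is_derive_warping (r t)) Dr)) as D2.
      pose proof (is_derive_minus _ _ t _ _ D1 D2) as D3.
      match type of D3 with is_derive _ _ ?l => replace 0 with l; [exact D3 |] end.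
      unfold minus, plus, opp, scal; simpl; unfold mult; simpl; ring. }
    assert (E0 : en 0 = 0).
    { unfold en; rewrite Ep, Er; fold nu.
      replace (1 + 0 ^ 2) with 1 by ring; rewrite sqrt_1; field; lra. }
    intros t; change (en t = 0); rewrite <- E0.
    destruct (Rtotal_order t 0) as [Hl | [-> | Hl]]; [| reflexivity |].
    - apply (eq_is_derive en t 0); [intros; apply Hd | exact Hl].
    - symmetry; apply (eq_is_derive en 0 t); [intros; apply Hd | exact Hl]. }
  assert (Hmr : forall t, m (r t) = nu * sqrt (1 + p t ^ 2)).
  { intros t; specialize (Hen t).
    apply (Rmult_eq_reg_l (/ nu)); [| apply Rinv_neq_0_compat; lra].
    replace (/ nu * (nu * sqrt (1 + p t ^ 2))) with (sqrt (1 + p t ^ 2)) by (field; lra); lra. }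
  exists r, (fun t => slope_to_speed (p t)); split; [exact Er |]; intros t.
  destruct (Hode t) as [Dr Dp]; destruct (sqrt_1_plus_sqr (p t)) as [S1 S2].
  split; [| split; [exact Dr | split]].
  - apply Rnot_le_lt; intros Hle.
    pose proof (warping_nonneg (- r t) ltac:(lra)) as Hn.
    rewrite (warping_odd m Hm), Hmr in Hn.
    pose proof (Rmult_lt_0_compat nu (sqrt (1 + p t ^ 2)) Hnu ltac:(lra)); lra.
  - pose proof (is_derive_comp slope_to_speed p t _ _
      (is_derive_slope_to_speed (p t)) Dp) as D.
    match type of D with is_derive _ _ ?l =>
      match goal with |- is_derive _ _ ?l' => replace l' with l; [exact D |] end end.
    unfold scal; simpl; unfold mult; simpl.
    rewrite Hmr; fold nu; simpl pow in *; field; lra.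
  - rewrite Hmr; fold nu; unfold slope_to_speed.
    transitivity ((p t ^ 2 + 1) / sqrt (1 + p t ^ 2) ^ 2); [field; lra |].
    rewrite S2; field; pose proof (pow2_ge_0 (p t)); lra.
Qed.

(** An h-geodesic in polar coordinates, rotated by the angle [mu * t].  The factor
    [1 + mu nu] in the momenta is constant, so the Euler-Lagrange equations of F reduce
    to those of the unit h-speed curve. *)
Lemma polar_geodesic (r w psi : R -> R) (nu : R) :
  (forall t, 0 < r t) -> (forall t, is_derive r t (w t)) ->
  (forall t, is_derive w t (nu ^ 2 * Derive m (r t) / m (r t) ^ 3)) ->
  (forall t, is_derive psi t (mu + nu / m (r t) ^ 2)) ->
  (forall t, w t ^ 2 + nu ^ 2 / m (r t) ^ 2 = 1) ->
  unit_speed_geodesic m mu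
    (fun t => (r t * cos (psi t), r t * sin (psi t))).
Proof.
  intros Hr Dr Dw Dpsi Hunit.
  assert (Hmp : forall t, 0 < m (r t)) by (intros t; apply (warping_pos m Hm), Hr).
  assert (Hb : exists b : R -> R, forall t, b t = mu + nu / m (r t) ^ 2) by (eexists; reflexivity).
  destruct Hb as [b Hb]; assert (Dpsi' : forall t, is_derive psi t (b t))
    by (intros t; rewrite Hb; apply Dpsi).
  set (x1 := fun t => r t * cos (psi t)); set (x2 := fun t => r t * sin (psi t)).
  set (v1 := fun t => w t * cos (psi t) - r t * b t * sin (psi t)).
  set (v2 := fun t => w t * sin (psi t) + r t * b t * cos (psi t)).
  set (g := fun t => (x1 t, x2 t)); set (v := fun t => (v1 t, v2 t)).
  change (unit_speed_geodesic m mu g).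
  assert (D1 : forall t, is_derive x1 t (v1 t)).
  { intros t; pose proof (Dr t) as Ar; pose proof (Dpsi' t) as Ap; unfold x1, v1; auto_derive.
    - repeat split; eexists; eassumption.
    - replace (Derive _ t) with (w t) by (symmetry; apply is_derive_unique, Ar).
      replace (Derive _ t) with (b t) by (symmetry; apply is_derive_unique, Ap). ring. }
  assert (D2 : forall t, is_derive x2 t (v2 t)).
  { intros t; pose proof (Dr t) as Ar; pose proof (Dpsi' t) as Ap; unfold x2, v2; auto_derive.
    - repeat split; eexists; eassumption.
    - replace (Derive _ t) with (w t) by (symmetry; apply is_derive_unique, Ar).
      replace (Derive _ t) with (b t) by (symmetry; apply is_derive_unique, Ap). ring. }
  assert (Db : forall t, ex_derive b t).
  { intros t; pose proof (is_derive_comp m r t _ _ (is_derive_warping (r t)) (Dr t)) as A.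
    apply (ex_derive_ext (fun s => mu + nu * / m (r s) ^ 2)).
    { intros s; rewrite Hb; reflexivity. }
    apply (ex_derive_plus (fun _ => mu) (fun s => nu * / m (r s) ^ 2)); [apply ex_derive_const |].
    apply (ex_derive_scal (fun s => / m (r s) ^ 2)), (ex_derive_inv (fun s => m (r s) ^ 2)).
    - apply (ex_derive_pow (fun s => m (r s))); eexists; exact A.
    - apply pow_nonzero; pose proof (Hmp t); lra. }
  assert (HC : C1_curve half_line g v).
  { apply C1_curve_of_derive; intros t _; [apply D1 | apply D2 | |];
      assert (Ew : ex_derive w t) by (eexists; apply Dw);
      assert (Er : ex_derive r t) by (eexists; apply Dr);
      assert (Ep : ex_derive psi t) by (eexists; apply Dpsi');
      pose proof (Db t) as Eb.
    - apply (ex_derive_continuous v1); unfold v1; auto_derive.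
      repeat split; assumption.
    - apply (ex_derive_continuous v2); unfold v2; auto_derive.
      repeat split; assumption. }
  assert (HR : forall t, radius (g t) = r t)
    by (intros t; apply radius_scaled_circle; [left; apply Hr | apply cos_sin_sqr]).
  assert (HA : forall t, dr (g t) (v t) = w t)
    by (intros t; apply dr_polar; [apply Hr | apply cos_sin_sqr]).
  assert (HB : forall t, dtheta (g t) (v t) = b t)
    by (intros t; apply dtheta_polar; [apply Hr | apply cos_sin_sqr]).
  assert (HN : forall t, angular_momentum (g t) (v t) = nu).
  { intros t; unfold angular_momentum; rewrite HR, HB, Hb.
    field; pose proof (Hmp t); lra. }
  assert (H0 : forall t, radius (g t) <> 0)
    by (intros t; rewrite HR; pose proof (Hr t); lra).
  assert (H1 : forall t, randers m mu (g t) (v t) = 1).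
  { intros t; apply (unit_vector_polar _ _ (H0 t)).
    rewrite HR, HA, HB, <- (Hunit t), Hb; field; pose proof (Hmp t); lra. }
  assert (HS : 1 + mu * nu <> 0).
  { pose proof (momentum_scale_pos _ _ (H0 0) (H1 0)) as H; rewrite HN in H; lra. }
  exists v; split; [exact HC |]; split; [intros t _; apply H1 |].
  split; intros t Ht; apply (filterdiff_within half_line); try exact Ht.
  - assert (Ey : forall s, energy_y1 m mu (g s) (v s)
                          = (w s * cos (psi s) - nu * sin (psi s) / r s) / (1 + mu * nu)).
    { intros s; rewrite (energy_y1_eq _ _ (H0 s) (H1 s)), HR, HA, HN.
      simpl fst; simpl snd; unfold x1, x2; field; pose proof (Hr s); split; lra. }
    apply (is_derive_ext (fun s => (w s * cos (psi s) - nu * sin (psi s) / r s) / (1 + mu * nu)));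
      [intros s; symmetry; apply Ey |].
    rewrite (energy_x1_eq _ _ (H0 t) (H1 t)), HR, HA, HB, HN.
    simpl fst; simpl snd; unfold x1, v1, v2.
    pose proof (Dr t) as Ar; pose proof (Dpsi' t) as Ap; pose proof (Dw t) as Aw.
    pose proof (Hr t) as Hrt; pose proof (Hmp t) as Hmt.
    auto_derive; [repeat split; try (eexists; eassumption); lra |].
    replace (Derive _ t) with (nu ^ 2 * Derive m (r t) / m (r t) ^ 3)
      by (symmetry; apply is_derive_unique, Aw).
    replace (Derive _ t) with (b t) by (symmetry; apply is_derive_unique, Ap).
    replace (Derive _ t) with (w t) by (symmetry; apply is_derive_unique, Ar).
    rewrite Hb; field; repeat split; lra.
  - assert (Ey : forall s, energy_y2 m mu (g s) (v s)
                          = (w s * sin (psi s) + nu * cos (psi s) / r s) / (1 + mu * nu)).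
    { intros s; rewrite (energy_y2_eq _ _ (H0 s) (H1 s)), HR, HA, HN.
      simpl fst; simpl snd; unfold x1, x2; field; pose proof (Hr s); split; lra. }
    apply (is_derive_ext (fun s => (w s * sin (psi s) + nu * cos (psi s) / r s) / (1 + mu * nu)));
      [intros s; symmetry; apply Ey |].
    rewrite (energy_x2_eq _ _ (H0 t) (H1 t)), HR, HA, HB, HN.
    simpl fst; simpl snd; unfold x2, v1, v2.
    pose proof (Dr t) as Ar; pose proof (Dpsi' t) as Ap; pose proof (Dw t) as Aw.
    pose proof (Hr t) as Hrt; pose proof (Hmp t) as Hmt.
    auto_derive; [repeat split; try (eexists; eassumption); lra |].
    replace (Derive _ t) with (nu ^ 2 * Derive m (r t) / m (r t) ^ 3)
      by (symmetry; apply is_derive_unique, Aw).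
    replace (Derive _ t) with (b t) by (symmetry; apply is_derive_unique, Ap).
    replace (Derive _ t) with (w t) by (symmetry; apply is_derive_unique, Ar).
    rewrite Hb; field; repeat split; lra.
Qed.

(** Reflection in the meridian of [x] reverses the winding angle [W] of the h-geodesic;
    the angles [PI] and [- PI] are those of the same point. *)
Lemma pole_is_vertex (x : R * R) : pole m mu x -> x = vertex.
Proof.
  intros Hpole.
  destruct (Req_dec (radius x) 0) as [H0 | H0]; [exact (radius_eq0 x H0) |].
  exfalso; pose proof (radius_nonneg x) as Hx.
  destruct (polar_angle x) as [th Ex].
  destruct (radial_profile (radius x) ltac:(lra)) as [r [w [Er Hrw]]].
  set (nu := m (radius x)) in *.
  assert (Hnu : 0 < nu) by (apply (warping_pos m Hm); lra).
  assert (Hmp : forall t, 0 < m (r t)) by (intros t; apply (warping_pos m Hm), Hrw).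
  set (k := fun t => nu / m (r t) ^ 2).
  assert (Hk : forall t, continuous k t).
  { intros t; apply (continuous_mult (fun _ => nu) (fun t => / m (r t) ^ 2));
      [apply continuous_const |].
    assert (Hc : continuous (fun t => m (r t)) t).
    { apply (continuous_comp r m).
      - apply (ex_derive_continuous r); eexists; apply Hrw.
      - apply (ex_derive_continuous m); eexists; apply is_derive_warping. }
    apply (continuous_Rinv_comp (fun t => m (r t) ^ 2)).
    - apply (continuous_mult (fun t => m (r t)) (fun t => m (r t) * 1)); [exact Hc |].
      apply (continuous_mult (fun t => m (r t)) (fun _ => 1)); [exact Hc | apply continuous_const].
    - apply pow_nonzero; pose proof (Hmp t); lra. }
  assert (Hke : forall t, nu * mu ^ 2 <= k t).
  { intros t; pose proof (Hmp t) as Hp.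
    pose proof (wind_subunit (r t) ltac:(left; apply Hrw)) as Hw.
    unfold k; apply (Rmult_le_reg_r (m (r t) ^ 2)); [apply pow_lt, Hp |].
    replace (nu / m (r t) ^ 2 * m (r t) ^ 2) with nu by (field; lra).
    rewrite Rmult_assoc; rewrite <- (Rmult_1_r nu) at 2.
    apply Rmult_le_compat_l; lra. }
  assert (He : 0 < nu * mu ^ 2) by (apply Rmult_lt_0_compat; [exact Hnu | apply pow_lt, Hmu]).
  destruct (unbounded_primitive k _ Hk He Hke) as [W [W0 [DW HW]]].
  pose proof PI_RGT_0 as HPI.
  destruct (HW PI ltac:(lra)) as [s [Hs Es]].
  destruct (HW (PI / 2) ltac:(lra)) as [u [Hu Eu]].
  assert (Hs0 : 0 < s) by (destruct Hs as [Hs | <-]; [exact Hs | lra]).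
  (* The sign [sg] distinguishes the two mirror images. *)
  set (g := fun (sg t : R) => (r t * cos (mu * t + (th + sg * W t)),
                               r t * sin (mu * t + (th + sg * W t)))).
  assert (Hg : forall sg, sg ^ 2 = 1 -> unit_speed_geodesic m mu (g sg)).
  { intros sg Hsg; apply (polar_geodesic r w (fun t => mu * t + (th + sg * W t)) (sg * nu));
      try (intros t; apply Hrw).
    - intros t; rewrite Rpow_mult_distr, Hsg, Rmult_1_l; apply Hrw.
    - intros t; pose proof (DW t) as D; auto_derive; [eexists; exact D |].
      replace (Derive _ t) with (k t) by (symmetry; apply is_derive_unique, D).
      unfold k; field; pose proof (Hmp t); lra.
    - intros t; rewrite Rpow_mult_distr, Hsg, Rmult_1_l; apply Hrw. }
  assert (Hg0 : forall sg, g sg 0 = x).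
  { intros sg; unfold g; rewrite W0, Er, !Rmult_0_r, Rplus_0_r, Rplus_0_l.
    symmetry; exact Ex. }
  refine (Hpole (g 1) (g (-1)) (Hg 1 _) (Hg (-1) _) (Hg0 1) (Hg0 (-1)) _ s s Hs0 Hs _).
  - ring.
  - ring.
  - exists u; split; [exact Hu |]; intros E; unfold g in E; rewrite Eu in E.
    replace (mu * u + (th + 1 * (PI / 2))) with ((mu * u + th) + PI / 2) in E by ring.
    replace (mu * u + (th + -1 * (PI / 2))) with ((mu * u + th) - PI / 2) in E by ring.
    rewrite (cos_plus _ (PI / 2)), (sin_plus _ (PI / 2)), cos_minus, sin_minus, cos_PI2,
      sin_PI2 in E.
    injection E as E1 E2; pose proof (proj1 (Hrw u)) as Hru.
    apply Rmult_eq_reg_l in E1; [| lra]; apply Rmult_eq_reg_l in E2; [| lra].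
    pose proof (cos_sin_sqr (mu * u + th)) as Hcs.
    assert (Ec : cos (mu * u + th) = 0) by lra; assert (Esn : sin (mu * u + th) = 0) by lra.
    rewrite Ec, Esn in Hcs; ring_simplify in Hcs; lra.
  - unfold g; rewrite Es.
    replace (mu * s + (th + 1 * PI)) with ((mu * s + th) + PI) by ring.
    replace (mu * s + (th + -1 * PI)) with ((mu * s + th) - PI) by ring.
    rewrite (cos_plus _ PI), (sin_plus _ PI), cos_minus, sin_minus, cos_PI, sin_PI.
    f_equal; ring.
Qed.

End Surface.

Theorem theorem1p4 (m : R -> R) (mu : R) :
  warping_function m ->
  0 < mu ->
  (forall r : R, 0 <= r -> m r < 1 / mu) ->
  (forall (q : R * R) (gamma : R -> R * R),
     q <> vertex ->
     unit_speed_geodesic m mu gamma ->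
     gamma 0 = q ->
     ~ tangent_to_twisted_meridian mu gamma ->
     ~ forward_ray m mu gamma) /\
  (forall x : R * R, pole m mu x <-> x = vertex).
Proof.
  intros Hm Hmu Hbound; split.
  - intros q gamma Hq _ <- Hnt Hray.
    exact (Hnt (ray_initially_tangent m mu Hm Hmu Hbound gamma Hq Hray)).
  - intros x; split; [apply (pole_is_vertex m mu Hm Hmu Hbound) |].
    intros ->; exact (vertex_is_pole m mu Hm Hmu Hbound).
Qed.
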